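(* Let $R\subseteq S$ be an étale, infra-integral Gilmer extension. Then $R\subseteq S$ has FIP if and only if the nucleus $R/(R:S)$ is a FMIR and, for each $M\in\mathrm{Supp}_R(S/R)$ such that $R_M$ is an infinite SPIR, the number of prime ideals of $S$ lying over $M$ is $2$.
   Context: Rings are commutative with identity. $(R:S)=\{r\in R\mid rS\subseteq R\}$; Gilmer extension: $R/(R:S)$ Artinian. Étale: flat, of finite presentation, unramified. Infra-integral: integral with all residual field extensions isomorphisms. FIP: finitely many $R$-subalgebras of $S$. A FMIR is a ring with only finitely many ideals. A SPIR is a local ring $R$ which is not a field, whose maximal ideal $M$ is principal and nilpotent (so $M$ is its unique prime ideal). *)

(* Defs.v *)
From HB Require Import structures.
From mathcomp Require Import all_boot all_order all_algebra.
From mathcomp Require Import mpoly.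
Set Implicit Arguments. Unset Strict Implicit. Unset Printing Implicit Defensive.
Import GRing.Theory.
Local Open Scope ring_scope.

Section Ideals.
Variable A : comNzRingType.

Definition is_ideal (I : A -> Prop) : Prop :=
  [/\ I 0, (forall x y, I x -> I y -> I (x + y)) & (forall a x, I x -> I (a * x))].

Definition is_prime (P : A -> Prop) : Prop :=
  [/\ is_ideal P, ~ P 1 & (forall x y, P (x * y) -> P x \/ P y)].

Definition same_set (I J : A -> Prop) : Prop := forall x, I x <-> J x.

(* The ideals of A / C are in canonical bijection with the ideals of A
   containing the ideal C; we use that description of the ideals of A/C. *)
Definition ideal_above (C I : A -> Prop) : Prop :=
  is_ideal I /\ (forall x, C x -> I x).

Definition quotient_artinian (C : A -> Prop) : Prop :=
  forall I : nat -> A -> Prop,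
    (forall k, ideal_above C (I k)) ->
    (forall k x, I k.+1 x -> I k x) ->
    exists N, forall k, (N <= k)%N -> same_set (I k) (I N).

Definition quotient_FMIR (C : A -> Prop) : Prop :=
  exists (n : nat) (Is : 'I_n -> A -> Prop),
    forall I, ideal_above C I -> exists i, same_set I (Is i).

(* ---------- the localization A_M, written out via fractions a/u, u \notin M ---------- *)
(* a/u = b/v in A_M *)
Definition loc_eq (M : A -> Prop) (a u b v : A) : Prop :=
  exists w, ~ M w /\ w * (a * v - b * u) = 0.

Definition loc_infinite (M : A -> Prop) : Prop :=
  forall (n : nat) (a u : 'I_n -> A), (forall i, ~ M (u i)) ->
    exists b v, ~ M v /\ forall i, ~ loc_eq M b v (a i) (u i).

(* For a prime M, A_M is local with maximal ideal M A_M (= {m/u | m \in M}).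
   A_M is a SPIR: not a field (M A_M <> 0), and M A_M is principal (generated
   by some p/1, p \in M; any generator p/u is associate to p/1) and nilpotent. *)
Definition loc_SPIR (M : A -> Prop) : Prop :=
  (exists m, M m /\ ~ loc_eq M m 1 0 1) /\
  (exists p n, M p /\
     (forall m, M m -> exists a u, ~ M u /\ loc_eq M m 1 (a * p) u) /\
     loc_eq M (p ^+ n) 1 0 1).

End Ideals.

Section Extensions.
Variables (R S : comNzRingType) (f : {rmorphism R -> S}).

Definition preim (Q : S -> Prop) : R -> Prop := fun r => Q (f r).

Definition conductor : R -> Prop :=
  fun r => forall s : S, exists r' : R, f r' = f r * s.

Definition Gilmer_ext : Prop := quotient_artinian conductor.

Definition integral_ext : Prop :=
  forall s : S, exists p : {poly R}, p \is monic /\ root (map_poly f p) s.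

(* residue field extension k(Q ∩ R) -> k(Q) is surjective (hence an isomorphism):
   every x/y in Frac(S/Q) equals the image of some a/b in Frac(R/P). *)
Definition residue_iso (Q : S -> Prop) : Prop :=
  forall x y : S, ~ Q y -> exists a b : R, ~ preim Q b /\ Q (f b * x - f a * y).

Definition infra_integral_ext : Prop :=
  integral_ext /\ forall Q, is_prime Q -> residue_iso Q.

Definition is_subalgebra (T : S -> Prop) : Prop :=
  [/\ forall r, T (f r), (forall x y, T x -> T y -> T (x + y)),
      (forall x, T x -> T (- x)) & (forall x y, T x -> T y -> T (x * y))].

Definition FIP_ext : Prop :=
  exists (n : nat) (Ts : 'I_n -> S -> Prop),
    forall T, is_subalgebra T -> exists i, same_set T (Ts i).

(* flatness, via the equational criterion *)
Definition flat_ext : Prop :=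
  forall (n : nat) (r : 'I_n -> R) (x : 'I_n -> S),
    \sum_(i < n) f (r i) * x i = 0 ->
    exists (m : nat) (a : 'I_n -> 'I_m -> R) (y : 'I_m -> S),
      (forall i, x i = \sum_(j < m) f (a i j) * y j) /\
      (forall j, \sum_(i < n) r i * a i j = 0).

Definition fin_pres_ext : Prop :=
  exists (n : nat) (x : 'I_n -> S),
    let phi := fun p : {mpoly R[n]} => mmap f x p in
    (forall s : S, exists p, phi p = s) /\
    exists (k : nat) (g : 'I_k -> {mpoly R[n]}),
      (forall j, phi (g j) = 0) /\
      (forall p, phi p = 0 -> exists q : 'I_k -> {mpoly R[n]},
                    p = \sum_(j < k) q j * g j).

Definition is_Rderivation (M : lmodType S) (d : S -> M) : Prop :=
  [/\ forall x y, d (x + y) = d x + d y,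
      forall x y, d (x * y) = x *: d y + y *: d x
    & forall (r : R) x, d (f r * x) = f r *: d x].

(* unramified: finite type (implied by finite presentation below) and
   Omega_{S/R} = 0, i.e. every R-derivation of S into any S-module is zero *)
Definition unramified_ext : Prop :=
  forall (M : lmodType S) (d : S -> M), is_Rderivation d -> forall x, d x = 0.

Definition etale_ext : Prop := [/\ flat_ext, fin_pres_ext & unramified_ext].

(* Supp_R(S/R): primes M of R with (S/R)_M <> 0 *)
Definition in_supp (M : R -> Prop) : Prop :=
  is_prime M /\ exists s : S, forall u : R, ~ M u -> ~ exists r, f r = f u * s.

Definition two_primes_over (M : R -> Prop) : Prop :=
  exists Q1 Q2 : S -> Prop,
    [/\ is_prime Q1 /\ same_set (preim Q1) M,
        is_prime Q2 /\ same_set (preim Q2) M,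
        ~ same_set Q1 Q2
      & forall Q, is_prime Q -> same_set (preim Q) M ->
          same_set Q Q1 \/ same_set Q Q2].

End Extensions.

(* Main.v *)
Require Import Defs.
From HB Require Import structures.
From mathcomp Require Import all_boot all_order all_algebra.
From mathcomp Require Import boolp ring.

(** Put C = (R:S), A = R/C and B = S/C. Since R -> S is finite, both A and B are
    Artinian, so each is a finite product of local rings with nil maximal ideals.
    Unramifiedness and the triviality of the residue extensions make A map onto
    every local factor of B. As A -> B has zero conductor, every local factor A_i
    of A lies under at least two factors of B. A relation c s = r with c in C, s in S
    and r in R is then a linear relation between elements s, 1 that can be chosen
    independent modulo a maximal ideal M containing C; by flatness C_M = 0, and A_i
    maps isomorphically to each factor of B above it. So B is the product of the
    powers A_i^(n_i) with n_i >= 2, where A_i = R_M, and everything reduces to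
    counting the A_i-subalgebras of A_i^(n_i):
    - an ideal I of A is recovered from the subalgebra A + I B, so FIP implies FMIR;
    - a local FMIR with infinite residue field is a field or a SPIR, and one with
      finite residue field is finite;
    - subalgebras of A_i^2 correspond to ideals, subalgebras of k^n to sets of
      idempotents;
    - if A_i is a SPIR with socle (q) and n_i >= 3, the subalgebras
      A_i + A_i q (e_1 + u e_2) are distinct for u distinct in the residue field. *)

Set Implicit Arguments. Unset Strict Implicit. Unset Printing Implicit Defensive.
Import GRing.Theory.
Local Open Scope ring_scope.
Local Open Scope quotient_scope.

(** * Quotients and restriction of scalars *)

Section IdealQuotient.
Variables (A : comNzRingType) (I : A -> Prop).
Hypotheses (idI : is_ideal I) (I1 : ~ I 1).

Let mem_I : {pred A} := fun x => `[< I x >].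

Fact mem_ideal_closed : idealr_closed mem_I.
Proof.
case: idI => I0 ID IM; split.
- exact/asboolP.
- by apply/asboolP.
- move=> a x y /asboolP Ix /asboolP Iy; apply/asboolP.
  by apply: ID => //; apply: IM.
Qed.

HB.instance Definition _ := isIdealr.Build A mem_I mem_ideal_closed.

Lemma ideal_quotient : exists (B : comNzRingType) (pi : {rmorphism A -> B}),
  (forall b, exists a, pi a = b) /\ (forall a, pi a = 0 <-> I a).
Proof.
pose pi : {rmorphism A -> {ideal_quot mem_I}} := \pi_({ideal_quot mem_I}).
exists {ideal_quot mem_I}, pi; split.
  by move=> b; exists (repr b); rewrite /pi /= reprK.
move=> a; rewrite -(rmorph0 pi).
have := Quotient.idealrBE mem_I a 0; rewrite subr0 => e.
by split=> [/eqP|Ia]; [rewrite -e => /asboolP | apply/eqP; rewrite -e; apply/asboolP].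
Qed.

End IdealQuotient.

Section Factor.
Variables (R A B : comNzRingType) (pi : {rmorphism R -> A}) (h : {rmorphism R -> B}).
Hypothesis pi_surj : forall a, exists r, pi r = a.
Hypothesis ker_pi : forall r, pi r = 0 -> h r = 0.

Let lft a := sval (cid (pi_surj a)).
Let lftK a : pi (lft a) = a. Proof. exact: svalP (cid (pi_surj a)). Qed.
(** The arbitrary lift is harmless: two lifts of [a] differ by an element of the kernel of [pi],
    which [h] kills. *)
Definition factor_map a := h (lft a).

Lemma factor_mapE r : factor_map (pi r) = h r.
Proof.
by apply/eqP; rewrite -subr_eq0 -rmorphB ker_pi // rmorphB lftK subrr.
Qed.

Fact factor_map_zmod : zmod_morphism factor_map.
Proof. by move=> a b; rewrite -(lftK a) -(lftK b) -rmorphB !factor_mapE rmorphB. Qed.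

Fact factor_map_monoid : monoid_morphism factor_map.
Proof.
split=> [|a b]; first by rewrite -(rmorph1 pi) factor_mapE rmorph1.
by rewrite -(lftK a) -(lftK b) -rmorphM !factor_mapE rmorphM.
Qed.

HB.instance Definition _ := GRing.isZmodMorphism.Build A B factor_map factor_map_zmod.
HB.instance Definition _ := GRing.isMonoidMorphism.Build A B factor_map factor_map_monoid.

Lemma factor_rmorphism : exists g : {rmorphism A -> B}, forall r, g (pi r) = h r.
Proof. exists factor_map; exact: factor_mapE. Qed.

End Factor.

(* [B] with the [S]-module structure obtained by restricting scalars along [pi] *)
Definition restr_scalars (S B : comNzRingType) (pi : {rmorphism S -> B}) : Type := B.

Section RestrScalars.
Variables (S B : comNzRingType) (pi : {rmorphism S -> B}).
HB.instance Definition _ := GRing.Zmodule.on (restr_scalars pi).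

Let scale (s : S) (x : restr_scalars pi) : restr_scalars pi := pi s * (x : B).

Fact restr_scaleA a b v : scale a (scale b v) = scale (a * b) v.
Proof. by rewrite /scale rmorphM mulrA. Qed.
Fact restr_scale1 : left_id 1 scale.
Proof. by move=> v; rewrite /scale rmorph1 mul1r. Qed.
Fact restr_scaleDr : right_distributive scale +%R.
Proof. by move=> a u v; rewrite /scale mulrDr. Qed.
Fact restr_scaleDl v : {morph scale^~ v : a b / a + b}.
Proof. by move=> a b; rewrite /scale rmorphD mulrDl. Qed.

HB.instance Definition _ := GRing.Zmodule_isLmodule.Build S (restr_scalars pi)
  restr_scaleA restr_scale1 restr_scaleDr restr_scaleDl.

Lemma restr_scaleE s (x : restr_scalars pi) : s *: x = pi s * (x : B).
Proof. by []. Qed.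
End RestrScalars.

(** * Finiteness up to a relation *)

(** Finiteness of the set of classes is expressed by an invariant with finitely many values that
    separates them. No quotient type is formed, and finiteness proofs become separation proofs. *)
Definition fin_mod (X : Type) (P : X -> Prop) (E : X -> X -> Prop) : Prop :=
  exists (K : finType) (c : X -> K),
    forall x y, P x -> P y -> c x = c y -> E x y.

Lemma fin_mod_of_cover (X : Type) (P : X -> Prop) (E : X -> X -> Prop) n (t : 'I_n -> X) :
  (forall x y z, E x z -> E y z -> E x y) ->
  (forall x, P x -> exists i, E x (t i)) -> fin_mod P E.
Proof.
move=> Etr cov; pose c x := if pselect (exists i, E x (t i)) is left h
  then Some (sval (cid h)) else None.
exists (option 'I_n), c => x y Px Py; rewrite /c.
case: pselect => [hx|nx]; last by case: nx; exact: cov.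
case: pselect => [hy|ny]; last by case: ny; exact: cov.
move=> [exy]; have := svalP (cid hx); rewrite exy => Ex.
exact: Etr Ex (svalP (cid hy)).
Qed.

(** The usual tool of the counting arguments: finiteness is pulled back along a map that reflects
    the relations, for example one from subalgebras to ideals. *)
Lemma fin_mod_comp (X Y : Type) (P : X -> Prop) (E : X -> X -> Prop)
    (Q : Y -> Prop) (F : Y -> Y -> Prop) (phi : Y -> X) :
  (forall y, Q y -> P (phi y)) ->
  (forall y y', Q y -> Q y' -> E (phi y) (phi y') -> F y y') ->
  fin_mod P E -> fin_mod Q F.
Proof.
move=> QP EF [K [c cP]]; exists K, (c \o phi) => x y Qx Qy /= e.
by apply: EF => //; apply: cP => //; apply: QP.
Qed.

Lemma fin_mod_all (X : Type) (I : finType) (P : X -> Prop) (E : I -> X -> X -> Prop) :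
  (forall i, fin_mod P (E i)) -> fin_mod P (fun x y => forall i, E i x y).
Proof.
move=> fE.
suff H (s : seq I) : fin_mod P (fun x y => forall i, i \in s -> E i x y).
  apply: (fin_mod_comp (phi := id)) (H (enum I)) => // x y _ _ e i.
  by apply: e; rewrite mem_enum.
elim: s => [|i s [K [c cP]]]; first by exists unit, (fun=> tt).
have [L [d dP]] := fE i.
exists (K * L)%type, (fun x => (c x, d x)) => x y Px Py [ec ed] j.
by rewrite inE => /predU1P[->|js]; [exact: dP | exact: cP js].
Qed.

Lemma fin_mod_cover (X : eqType) (P : X -> Prop) (E : X -> X -> Prop) :
  fin_mod P E -> exists s : seq X, (forall y, y \in s -> P y) /\
    forall x, P x -> exists2 y, y \in s & E x y.
Proof.
move=> [K [c cP]].
suff [s [sP sK]] : exists s : seq X, (forall y, y \in s -> P y) /\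
    forall x, P x -> c x \in enum K -> exists2 y, y \in s & c x = c y.
  exists s; split=> // x Px; have [|y ys e] := sK x Px; first by rewrite mem_enum.
  by exists y => //; apply: cP => //; apply: sP.
elim: (enum K) => [|k ks [s [sP sK]]]; first by exists [::].
have [[x [Px ck]]|nk] := pselect (exists x, P x /\ c x = k).
  exists (x :: s); split=> [y|y Py].
    by rewrite inE => /predU1P[->|/sP].
  rewrite inE => /predU1P[cy|cy]; first by exists x; rewrite ?mem_head ?ck.
  by have [z zs e] := sK y Py cy; exists z; rewrite // inE zs orbT.
exists s; split=> // x Px; rewrite inE => /predU1P[cx|]; last exact: sK.
by case: nk; exists x.
Qed.

Lemma fin_mod_family (X : Type) (P : (X -> Prop) -> Prop) (E : (X -> Prop) -> (X -> Prop) -> Prop) :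
  (forall T T', E T T' -> forall x, T x <-> T' x) -> fin_mod P E ->
  exists n (Ts : 'I_n -> X -> Prop), forall T, P T -> exists i, forall x, T x <-> Ts i x.
Proof.
move=> Es [K [c cP]]; exists #|K|, (fun i x => exists T, [/\ P T, c T = enum_val i & T x]).
move=> T PT; exists (enum_rank (c T)) => x; rewrite enum_rankK; split=> [Tx|].
  by exists T.
by move=> [T' [PT' cT' T'x]]; apply/(Es T T') => //; apply: cP.
Qed.

(** * Artinian rings *)

Section Artinian.
Variable A : comNzRingType.
Implicit Types (I J P : A -> Prop) (a b e x y : A).

Lemma ideal_sum I (K : Type) (s : seq K) (p : pred K) (F : K -> A) :
  is_ideal I -> (forall k, p k -> I (F k)) -> I (\sum_(k <- s | p k) F k).
Proof. by move=> [I0 ID _] IF; apply: big_ind. Qed.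

Lemma idealN I x : is_ideal I -> I x -> I (- x).
Proof. by move=> [_ _ IM] Ix; rewrite -mulN1r; apply: IM. Qed.

Lemma idealB I x y : is_ideal I -> I x -> I y -> I (x - y).
Proof. by move=> iI Ix Iy; case: (iI) => _ ID _; apply: ID => //; apply: idealN. Qed.

Lemma idealMl I a x : is_ideal I -> I x -> I (a * x).
Proof. by move=> [_ _]; apply. Qed.

Lemma idealMr I a x : is_ideal I -> I x -> I (x * a).
Proof. by move=> iI Ix; rewrite mulrC; apply: idealMl. Qed.

Lemma primeX P x n : is_prime P -> P (x ^+ n) -> P x.
Proof.
move=> [_ P1 PM]; elim: n => [|n IH]; first by rewrite expr0.
by rewrite exprS => /PM[].
Qed.

Definition pideal x : A -> Prop := fun y => exists a, y = a * x.

Lemma pideal_ideal x : is_ideal (pideal x).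
Proof.
split; first by exists 0; rewrite mul0r.
- by move=> _ _ [a ->] [b ->]; exists (a + b); rewrite mulrDl.
- by move=> a _ [b ->]; exists (a * b); rewrite mulrA.
Qed.

Lemma pideal_refl x : pideal x x.
Proof. by exists 1; rewrite mul1r. Qed.

Lemma pideal_sub I x y : is_ideal I -> I x -> pideal x y -> I y.
Proof. by move=> iI Ix [a ->]; apply: idealMl. Qed.

Definition artinian : Prop :=
  forall I : nat -> A -> Prop, (forall k, is_ideal (I k)) ->
    (forall k x, I k.+1 x -> I k x) ->
    exists N, forall k, (N <= k)%N -> same_set (I k) (I N).

Lemma decreasing_leq (I : nat -> A -> Prop) :
  (forall k x, I k.+1 x -> I k x) ->
  forall k l, (k <= l)%N -> forall x, I l x -> I k x.
Proof.
move=> Idec k; elim=> [|l IH]; first by rewrite leqn0 => /eqP->.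
rewrite leq_eqVlt => /orP[/eqP-> //|]; rewrite ltnS => kl x /Idec; exact: IH.
Qed.

Hypothesis artA : artinian.

(** Without a minimal member, dependent choice would iterate strict descent into a chain that never
    stabilises. *)
Lemma minimal_ideal (F : (A -> Prop) -> Prop) :
  (exists2 I, is_ideal I & F I) ->
  exists I, [/\ is_ideal I, F I &
    forall J, is_ideal J -> F J -> (forall x, J x -> I x) -> forall x, I x -> J x].
Proof.
move=> [I0 iI0 FI0]; apply: contrapT => /forallNP nmin.
pose T := {I : A -> Prop | is_ideal I /\ F I}.
have step (I : T) : {J : T | (forall x, sval J x -> sval I x) /\
    exists x, sval I x /\ ~ sval J x}.
  apply: cid; case: I => I [iI FI] /=.
  apply: contrapT => H'; apply: (nmin I); split=> // J iJ FJ JI x Ix.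
  apply: contrapT => nJx; apply: H'.
  by exists (exist _ J (conj iJ FJ)); split=> //; exists x.
pose s n : T := iter n (fun I : T => sval (step I)) (exist _ I0 (conj iI0 FI0)).
have [|k x|N HN] := artA (I := fun n => sval (s n)).
- by move=> k; case: (svalP (s k)).
- by have [+ _] := svalP (step (s k)); apply.
have [_ [x [sx nx]]] := svalP (step (s N)).
by apply: nx; apply/(HN N.+1).
Qed.

(** Well-founded induction on strict inclusion, by a minimal counterexample. *)
Lemma ideal_induction (F : (A -> Prop) -> Prop) :
  (forall I, is_ideal I ->
    (forall J, is_ideal J -> (forall x, J x -> I x) -> (exists x, I x /\ ~ J x) -> F J) ->
    F I) -> forall I, is_ideal I -> F I.
Proof.
move=> Find I iI; apply: contrapT => nFI.
have [|J [iJ nFJ Jmin]] := @minimal_ideal (fun I => ~ F I); first by exists I.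
apply: nFJ; apply: Find => // K iK KJ [x [Jx nKx]].
by apply: contrapT => nFK; apply: nKx; apply: Jmin.
Qed.

Lemma power_stable a : exists n b, a ^+ n = a ^+ n.+1 * b.
Proof.
have [|k x [b ->]|N HN] := artA (I := fun n => pideal (a ^+ n)).
- by move=> k; apply: pideal_ideal.
- by exists (b * a); rewrite exprS mulrA.
have [_ /(_ (pideal_refl _)) [b eb]] := HN N.+1 (leqnSn _) (a ^+ N).
by exists N, b; rewrite mulrC.
Qed.

(** The powers of [a] generate a stationary chain, so the ring splits into a factor where [a] is
    invertible and one where it is nilpotent; [e] is the identity of the first. *)
Lemma idempotent_multiple a : exists e b n,
  [/\ e * e = e, e = a * b & a ^+ n.+1 * (1 - e) = 0].
Proof.
have [n [b ab]] := power_stable a.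
have st k : a ^+ n = a ^+ (n + k) * b ^+ k.
  elim: k => [|k IH]; first by rewrite addn0 mulr1.
  rewrite {1}IH exprD {1}ab addnS !exprS exprD; ring.
have st' : a ^+ n.+1 * (a ^+ n.+1 * b ^+ n.+1) = a ^+ n.+1.
  by rewrite mulrA -exprD addSn exprS -mulrA -st -exprS.
(* The exponent is [n.+1] and not [n] so that the idempotent is a multiple of [a] even when
   [n = 0]. *)
exists (a ^+ n.+1 * b ^+ n.+1), (a ^+ n * b ^+ n.+1), n; split.
- by rewrite {1}[_ * b ^+ _]mulrC -mulrA st' mulrC.
- by rewrite exprS mulrA.
- by rewrite mulrBr st' mulr1 subrr.
Qed.

Lemma prime_maximal P b : is_prime P -> ~ P b -> exists c, P (1 - b * c).
Proof.
move=> pP nPb; have [n [c bc]] := power_stable b; exists c.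
have [iP P1 PM] := pP.
have : P (b ^+ n * (1 - b * c)).
  by rewrite mulrBr mulr1 mulrA -exprSr -bc subrr; case: iP.
by move=> /PM[/(primeX pP)|].
Qed.

(* [e] is an idempotent such that the ring [e A] is local with nil maximal ideal *)
Definition local_idem e : Prop :=
  [/\ e * e = e, e != 0 &
      forall a, (exists k, a ^+ k * e = 0) \/ (exists b, a * b * e = e)].

(** For a local idempotent [e] this is the prime of [A] obtained by pulling back the maximal ideal
    of the factor [e A]. *)
Definition nil_at e : A -> Prop := fun a => exists k, a ^+ k * e = 0.

Lemma unit_notnil e a b : local_idem e -> a * b * e = e -> ~ nil_at e a.
Proof.
move=> [ee e0 _] ab [k ak]; move/negP: e0; apply; apply/eqP.
have H n : (a * b) ^+ n * e = e.
  by elim: n => [|n IH]; rewrite ?mul1r // exprSr -mulrA ab.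
by rewrite -(H k) exprMn mulrAC ak mul0r.
Qed.

Lemma notnil_unit e a : local_idem e -> ~ nil_at e a -> exists b, a * b * e = e.
Proof. by case=> _ _ /(_ a)[]. Qed.

Lemma nil_at_prime e : local_idem e -> is_prime (nil_at e).
Proof.
move=> le; have [ee e0 dich] := le; split; first split.
- by exists 1%N; rewrite expr1 mul0r.
- move=> x y [k xk] [l yl]; exists (k + l)%N; rewrite exprDn mulr_suml.
  apply: big1 => i _; rewrite -mulr_natl -!mulrA.
  (* In every binomial term either the exponent of [y] is at least [l] or that of [x] is at least
     [k]. *)
  have [li|il] := leqP l i.
    have -> : (i = l + (i - l) :> nat)%N by rewrite subnKC.
    rewrite [y ^+ (_ + _)]exprD.
    have -> : y ^+ l * y ^+ (i - l) * e = y ^+ l * e * y ^+ (i - l) by ring.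
    by rewrite yl mul0r !mulr0.
  have -> : (k + l - i = k + (l - i))%N by rewrite addnBA // ltnW.
  rewrite exprD.
  have -> : x ^+ k * x ^+ (l - i) * (y ^+ i * e) = x ^+ k * e * (x ^+ (l - i) * y ^+ i).
    by ring.
  by rewrite xk mul0r mulr0.
- by move=> a x [k xk]; exists k; rewrite exprMn -mulrA xk mulr0.
- by move=> [k]; rewrite expr1n mul1r => /eqP; apply/negP.
- move=> x y xy; have [|/(notnil_unit le)[b xb]] := pselect (nil_at e x); first by left.
  have [|/(notnil_unit le)[c yc]] := pselect (nil_at e y); first by right.
  case: (unit_notnil (b := b * c) le _ xy).
  have -> : x * y * (b * c) * e = (x * b) * (y * c * e) by ring.
  by rewrite yc.
Qed.

Lemma nil_at_ideal e : local_idem e -> is_ideal (nil_at e).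
Proof. by move=> /nil_at_prime[]. Qed.

(** The total [h] is kept arbitrary, rather than 1, so that a decomposition can be built by
    induction on smaller idempotents. *)
Definition local_decomposition (K : finType) (h : A) (e : K -> A) : Prop :=
  [/\ forall k, local_idem (e k), forall k l, k != l -> e k * e l = 0
    & \sum_k e k = h].

Lemma local_decompositionMl (K : finType) h (e : K -> A) k :
  local_decomposition h e -> h * e k = e k.
Proof.
move=> [le oe <-]; rewrite mulr_suml (bigD1 k) //= big1 ?addr0 => [|l lk].
  by case: (le k).
exact: oe.
Qed.

(** Induction on the ideal [h A]. If [h A] is not local, some [a] is neither nilpotent nor
    invertible there, and it yields an idempotent [e] that cuts [h] into [e] and [h - e], both
    generating strictly smaller ideals. *)
Lemma local_decomposition_idem h : h * h = h ->
  exists (K : finType) (e : K -> A), local_decomposition h e.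
Proof.
suff H : forall I, is_ideal I -> forall h, h * h = h -> same_set I (pideal h) ->
    exists (K : finType) (e : K -> A), local_decomposition h e.
  by move=> hh; apply: (H (pideal h)) => //; apply: pideal_ideal.
apply: ideal_induction => I iI IH {}h hh Ih.
have [->|h0] := eqVneq h 0.
  by exists void, (fun=> 0); split=> [[]|[]|]; rewrite big1.
have [dich|/existsNP[a /not_orP[nnil nunit]]] := pselect (forall a,
    (exists k, a ^+ k * h = 0) \/ (exists b, a * b * h = h)).
  by exists unit, (fun=> h); split=> [|[] []//|]; rewrite ?big_const ?card_unit /= ?addr0.
(* Using [a * h] in place of [a] makes [e] a multiple of [h]. Then [e] is nonzero since [a] is not
   nilpotent on [h], and differs from [h] since [a] is not invertible there. *)
have [e [b [n [ee eab en]]]] := idempotent_multiple (a * h).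
have eh : e * h = e by rewrite eab -!mulrA [b * h]mulrC !mulrA -[a * h * h]mulrA hh.
have hn m : h ^+ m.+1 = h by elim: m => // m IHm; rewrite exprS IHm.
have e_neq0 : e <> 0.
  move=> e0; apply: nnil; exists n.+1.
  by rewrite -[in RHS]en e0 subr0 mulr1 exprMn hn.
have e_neqh : e <> h.
  move=> e_h; apply: nunit; exists b; rewrite -[in RHS]e_h eab; ring.
have [|||K1 [e1 d1]] := IH (pideal e) (pideal_ideal e) _ _ e ee; last first.
- have hehe : (h - e) * (h - e) = h - e.
    have -> : (h - e) * (h - e) = h * h - e * h - e * h + e * e by ring.
    by rewrite hh eh ee; ring.
  have [|||K2 [e2 d2]] := IH (pideal (h - e)) (pideal_ideal _) _ _ _ hehe; last first.
  + exists (K1 + K2)%type, (fun k => match k with inl k => e1 k | inr k => e2 k end).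
    have o12 k l : e1 k * e2 l = 0.
      rewrite -(local_decompositionMl k d1) -(local_decompositionMl l d2).
      have -> : e * e1 k * ((h - e) * e2 l) = (e * h - e * e) * (e1 k * e2 l) by ring.
      by rewrite eh ee subrr mul0r.
    case: d1 d2 => l1 o1 s1 [l2 o2 s2]; split.
    * by case.
    * move=> [k|k] [l|l] // kl; first exact: o1.
      - by rewrite mulrC.
      - exact: o2.
    * by rewrite big_sumType /= s1 s2 addrC subrK.
  + by [].
  + exists h; split; first by apply/Ih; exact: pideal_refl.
    move=> [c hc]; apply: e_neq0.
    rewrite -eh {1}hc.
    have -> : e * (c * (h - e)) = c * (e * h - e * e) by ring.
    by rewrite eh ee subrr mulr0.
  + move=> x [c ->]; apply/Ih; exists (c * (1 - e)).
    by rewrite -mulrA mulrBl mul1r eh.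
- by [].
- exists h; split; first by apply/Ih; exact: pideal_refl.
  move=> [c hc]; apply: e_neqh.
  by rewrite -eh {1}hc mulrCA ee -hc.
- by move=> x [c ->]; apply/Ih; exists (c * e); rewrite -mulrA eh.
Qed.

Section Decomposed.
Variables (K : finType) (e : K -> A).
Hypothesis de : local_decomposition 1 e.

Lemma decomp_eq x y : (forall k, x * e k = y * e k) -> x = y.
Proof.
move=> H; case: de => _ _ s.
by rewrite -[x]mulr1 -[y]mulr1 -s !mulr_sumr; apply: eq_bigr => k _.
Qed.

(** A proper ideal misses some [e k], as these sum to 1. An element of [P] invertible on [e k] would
    put [e k] into [P], and primality gives the other inclusion. *)
Lemma decomp_prime P : is_prime P -> exists k, same_set P (nil_at (e k)).
Proof.
move=> pP; have [iP P1 PM] := pP; have [le oe se] := de.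
have [k nPk] : exists k, ~ P (e k).
  by apply/existsNP => Pe; apply: P1; rewrite -se; apply: ideal_sum.
exists k => x; split=> [Px|[n xn]].
  apply: contrapT => /(notnil_unit (le k))[b xb]; apply: nPk; rewrite -xb.
  by apply: (idealMr _ iP); apply: (idealMr _ iP).
have : P (x ^+ n * e k) by rewrite xn; case: iP.
by move=> /PM[/(primeX pP)|/nPk].
Qed.

Lemma nil_at_inj k l : same_set (nil_at (e k)) (nil_at (e l)) -> k = l.
Proof.
have [le oe se] := de.
move=> kl; apply/eqP; apply: contrapT => /negP nkl.
have : nil_at (e k) (e l) by exists 1%N; rewrite expr1 mulrC oe.
by move=> /kl; apply: (unit_notnil (b := 1) (le l)); rewrite mulr1; case: (le l).
Qed.

End Decomposed.
End Artinian.

(** * Rings with finitely many ideals *)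

Section FiniteIdeals.
Variable A : comNzRingType.
Implicit Types (a b e x y p : A).

Definition fin_ideals : Prop := fin_mod (@is_ideal A) (@same_set A).

Lemma quotient_FMIR_fin_ideals : quotient_FMIR (fun x : A => x = 0) <-> fin_ideals.
Proof.
split=> [[n [Is IsP]]|fi].
  apply: (fin_mod_of_cover (t := Is)) => [I J K IK JK x|I iI].
    by split=> [/IK/JK|/JK/IK].
  by apply: IsP; split=> // x ->; case: iI.
have [//|n [Is IsP]] := fin_mod_family _ fi.
by exists n, Is => I [iI _]; apply: IsP.
Qed.

Definition residue_finite e : Prop :=
  fin_mod (fun _ : A => True) (fun a b => nil_at e (a - b)).

Definition component_finite e : Prop := exists s : seq A, forall a, a * e \in s.

Variable e : A.
Hypothesis le : local_idem e.

(** Nakayama for a nil ideal: iterating the equation puts arbitrary powers of [a] in front of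
    [x]. *)
Lemma nil_at_absorb a x : nil_at e a -> x * e = a * x * e -> x * e = 0.
Proof.
move=> [k ak] xax; have H n : x * e = a ^+ n * x * e.
  elim: n => [|n IH]; first by rewrite mul1r.
  rewrite {1}IH -mulrA xax exprSr; ring.
by rewrite (H k) mulrAC ak mul0r.
Qed.

Section Finite.
Hypotheses (artA : artinian A) (fiA : fin_ideals).

(** Induction on the ideal generated by [x * e]. Modulo the maximal ideal [a] has finitely many
    representatives [c], and [(a - c) * x * e] lies in one of finitely many ideals, each strictly
    smaller by [nil_at_absorb]. *)
Lemma residue_finite_component : residue_finite e -> component_finite e.
Proof.
move=> rf.
suff H : forall I, is_ideal I -> forall x, same_set I (pideal (x * e)) ->
    exists s : seq A, forall a, a * (x * e) \in s.
  have [//|s sP] := H (pideal (1 * e)) (pideal_ideal _) 1.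
  by exists s => a; rewrite -[e]mul1r; apply: sP.
apply: (ideal_induction artA) => I iI IH x Ix.
have [xe0|xe0] := eqVneq (x * e) 0.
  by exists [:: 0] => a; rewrite xe0 mulr0 mem_head.
have [cs [_ csP]] := fin_mod_cover rf.
(* Finiteness of the set of ideals allows finitely many multipliers [n] to represent all the ideals
   generated by [m * x * e]. *)
have [N [Nnil NP]] : exists s : seq A, (forall y, y \in s -> nil_at e y) /\
    forall m, nil_at e m -> exists2 n, n \in s &
      same_set (pideal (m * x * e)) (pideal (n * x * e)).
  apply: fin_mod_cover; apply: (fin_mod_comp (phi := fun m => pideal (m * x * e))) fiA => //.
  by move=> y _; exact: pideal_ideal.
have /choice[sf sfP] : forall n, exists s : seq A, nil_at e n ->
    forall a, a * (n * x * e) \in s.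
  move=> n; have [nn|] := pselect (nil_at e n); last by exists [::].
  have [|||s sP] := IH (pideal (n * x * e)) (pideal_ideal _) _ _ (n * x); last by exists s.
  - by move=> y [b ->]; apply/Ix; exists (b * n); ring.
  - exists (x * e); split; first by apply/Ix; exact: pideal_refl.
    move=> [b xb]; move/eqP: xe0; apply; apply: (nil_at_absorb (a := b * n)).
      exact/(idealMl _ (nil_at_ideal le)).
    by rewrite {1}xb; ring.
  - by [].
exists [seq c * (x * e) + t | c <- cs, t <- flatten (map sf N)] => a.
have [c ccs nac] := csP a Logic.I.
have [n nN mn] := NP _ nac.
have [d ed] := (mn _).1 (pideal_refl _).
have -> : a * (x * e) = c * (x * e) + (a - c) * x * e by ring.
apply: (allpairs_f (fun c t => c * (x * e) + t)) => //.
rewrite ed; apply/flattenP; exists (sf n); first exact: map_f.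
exact/sfP/Nnil.
Qed.

(** With an infinite residue field, two of the ideals generated by [x + u y] and [x + v y] coincide
    with [u - v] invertible. That ideal contains [(u - v) y], hence [y] and then [x]. *)
Lemma two_generators x y : ~ residue_finite e -> exists u,
  pideal ((x + u * y) * e) (x * e) /\ pideal ((x + u * y) * e) (y * e).
Proof.
move=> nrf; apply: contrapT => H; apply: nrf.
apply: (fin_mod_comp (phi := fun u => pideal ((x + u * y) * e))) fiA.
  by move=> u _; exact: pideal_ideal.
move=> u v _ _ uv; apply: contrapT => /(notnil_unit le)[b ub]; apply: H; exists u.
have iz := pideal_ideal ((x + u * y) * e).
have zu := pideal_refl ((x + u * y) * e).
have zv : pideal ((x + u * y) * e) ((x + v * y) * e) by apply/uv; exact: pideal_refl.
have zy : pideal ((x + u * y) * e) (y * e).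
  have -> : y * e = b * ((x + u * y) * e - (x + v * y) * e).
    rewrite -{1}ub; ring.
  by apply: (idealMl _ iz); exact: idealB.
split=> //; have -> : x * e = (x + u * y) * e - u * (y * e) by ring.
by apply: idealB => //; exact: (idealMl _ iz).
Qed.

(** Finitely many elements generate all the principal ideals inside the maximal ideal;
    [two_generators] merges them one by one into a single generator. *)
Lemma nil_at_principal : ~ residue_finite e ->
  exists2 p, nil_at e p & forall m, nil_at e m -> exists a, m * e = a * (p * e).
Proof.
move=> nrf.
have [N [Nnil NP]] : exists s : seq A, (forall y, y \in s -> nil_at e y) /\
    forall m, nil_at e m -> exists2 n, n \in s &
      same_set (pideal (m * e)) (pideal (n * e)).
  apply: fin_mod_cover; apply: (fin_mod_comp (phi := fun m => pideal (m * e))) fiA => //.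
  by move=> y _; exact: pideal_ideal.
have [p np pP] : exists2 p, nil_at e p & forall n, n \in N -> pideal (p * e) (n * e).
  elim: N Nnil {NP} => [_|n N IH Nnil].
    by exists 0 => //; case: (nil_at_ideal le).
  have [|p np pP] := IH; first by move=> y yN; apply: Nnil; rewrite inE yN orbT.
  have [u [zp zn]] := two_generators p n nrf.
  exists (p + u * n).
    have [_ ND _] := nil_at_ideal le; apply: ND => //.
    by apply: (idealMl _ (nil_at_ideal le)); apply: Nnil; exact: mem_head.
  move=> m; rewrite inE => /predU1P[-> //|/pP].
  exact: pideal_sub (pideal_ideal _) zp.
exists p => // m /NP[n nN mn]; apply: (pideal_sub (pideal_ideal _) (pP n nN)).
by apply/mn; exact: pideal_refl.
Qed.

End Finite.

Section LocalizationAt.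
Variable M : A -> Prop.
Hypothesis Me : same_set M (nil_at e).

(** The localization at [M] is the factor [e A]: elements outside [M] are the ones invertible on
    [e], and [e] itself serves as the multiplier [w]. *)
Lemma loc_eq_component a u b v : loc_eq M a u b v <-> (a * v - b * u) * e = 0.
Proof.
have [ee e0 _] := le; split=> [[w [Mw wz]]|H].
  have [c wc] : exists c, w * c * e = e by apply: notnil_unit => // /Me.
  have -> : (a * v - b * u) * e = c * e * (w * (a * v - b * u)) by rewrite -{1}wc; ring.
  by rewrite wz mulr0.
exists e; split; last by rewrite mulrC.
by move/Me; apply: (unit_notnil (b := 1) le); rewrite mulr1.
Qed.

Lemma loc_infinite_component : loc_infinite M <-> ~ component_finite e.
Proof.
split=> [inf [s sP]|nfin n a u Mu].
  have [|b [v [Mv bv]]] := inf (size s) (fun i => s`_i) (fun=> 1).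
    by move=> _ /Me; case: (nil_at_prime le).
  have [c vc] : exists c, v * c * e = e by apply: notnil_unit => // /Me.
  have bs := sP (b * c); have ibs := bs; rewrite -index_mem in ibs.
  case: (bv (Ordinal ibs)); apply/loc_eq_component; rewrite /= nth_index // mulr1.
  rewrite mulrBl; have -> : b * c * e * v * e = b * (v * c * e) * e by ring.
  by rewrite vc -mulrA; case: le => -> _ _; rewrite subrr.
have /choice[c uc] : forall i, exists c, u i * c * e = e.
  by move=> i; apply: notnil_unit => // /Me; exact: Mu.
have [b bs] : exists b, b * e \notin [seq a i * c i * e | i <- enum 'I_n].
  apply: contrapT => H; apply: nfin; exists [seq a i * c i * e | i <- enum 'I_n] => b.
  by apply: contrapT => /negP nb; apply: H; exists b.
exists b, 1; split; first by move=> /Me; case: (nil_at_prime le).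
move=> i /loc_eq_component; rewrite mulr1 mulrBl => /eqP; rewrite subr_eq0 => /eqP bu.
move/negP: bs; apply; apply/mapP; exists i; first by rewrite mem_enum.
have -> : b * e = c i * (b * u i * e) by rewrite -{1}(uc i); ring.
by rewrite bu; ring.
Qed.

(** Nilpotency of the generator disappears from the right-hand side because membership in [nil_at e]
    already provides it. *)
Lemma loc_SPIR_component : loc_SPIR M <->
  (exists2 m, nil_at e m & m * e <> 0) /\
  (exists2 p, nil_at e p & forall m, nil_at e m -> exists a, m * e = a * (p * e)).
Proof.
split=> [[[m [Mm m0]] [p [n [Mp [pP _]]]]]|[[m nm m0] [p np pP]]].
  split.
    exists m; first exact/Me.
    by move=> me; apply: m0; apply/loc_eq_component; rewrite mul0r mulr1 subr0.
  exists p => [|{m0}m' /Me Mm']; first exact/Me.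
  have [a [u [Mu /loc_eq_component]]] := pP m' Mm'.
  have [c uc] : exists c, u * c * e = e by apply: notnil_unit => // /Me.
  rewrite mulr1 mulrBl => /eqP; rewrite subr_eq0 => /eqP mu.
  exists (c * a); have -> : m' * e = c * (m' * u * e) by rewrite -{1}uc; ring.
  by rewrite mu; ring.
split.
  exists m; split; first exact/Me.
  by move/loc_eq_component; rewrite mul0r subr0 mulr1.
have [k pk] := np; exists p, k; split; first exact/Me.
split; last by apply/loc_eq_component; rewrite mul0r subr0 mulr1.
move=> m' /Me/pP[a ma]; exists a, 1; split; first by move=> /Me; case: (nil_at_prime le).
by apply/loc_eq_component; rewrite !mulr1 mulrBl ma mulrA subrr.
Qed.

End LocalizationAt.
End FiniteIdeals.

(** * The decomposition of B over A *)

(* The properties of [R/(R:S) -> S/(R:S)] that the argument uses. The last one is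
   the consequence of flatness: [S_Q] is faithful over [R_M]. *)
Record split_unramified (A B : comNzRingType) (g : {rmorphism A -> B}) : Prop :=
  SplitUnramified {
    su_inj : injective g;
    su_artA : artinian A;
    su_artB : artinian B;
    su_conductor : forall a, conductor g a -> a = 0;
    su_residue : forall Q, is_prime Q -> forall b, exists a, Q (b - g a);
    su_unramified : forall Q, is_prime Q -> forall J, is_ideal J ->
      (forall x y, Q x -> Q y -> J (x * y)) ->
      (forall a, Q (g a) -> J (g a)) -> forall x, Q x -> J x;
    su_faithful : forall Q Q', is_prime Q -> is_prime Q' -> ~ same_set Q Q' ->
      same_set (Defs.preim g Q) (Defs.preim g Q') ->
      forall a x, g a * x = 0 -> ~ Q x -> exists2 w, ~ Q (g w) & w * a = 0 }.

(** Encoded as an intersection, so that a member is used by testing it against a suitable ideal [K]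
    instead of unfolding a finite sum. *)
Definition prod_ideal (A : comNzRingType) (I J : A -> Prop) : A -> Prop :=
  fun x => forall K, is_ideal K -> (forall y z, I y -> J z -> K (y * z)) -> K x.

Lemma prod_ideal_ideal (A : comNzRingType) (I J : A -> Prop) : is_ideal (prod_ideal I J).
Proof.
split=> [K [] //|x y Ix Iy K iK HK|a x Ix K iK HK].
  by case: (iK) => _ KD _; apply: KD; [apply: Ix | apply: Iy].
by apply: (idealMl _ iK); apply: Ix.
Qed.

Lemma prod_idealM (A : comNzRingType) (I J : A -> Prop) x y :
  I x -> J y -> prod_ideal I J (x * y).
Proof. by move=> Ix Jy K _; apply. Qed.

Section Components.
Variables (A B : comNzRingType) (g : {rmorphism A -> B}).
Hypothesis su : split_unramified g.
Let artB := su_artB su.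

(* [J] is minimal among the ideals inside [Q] with [B = g(A) + J]; unramifiedness
   gives [B = g(A) + Q J], so [J = Q J] on the component [eps B], where [Q] is nil. *)
Lemma component_generated eps : local_idem eps ->
  forall b, exists a, b * eps = g a * eps.
Proof.
move=> leps; have [ee e0 _] := leps.
set Q := nil_at eps; have pQ : is_prime Q by exact: nil_at_prime.
have iQ : is_ideal Q by case: pQ.
have eps0 : (1 - eps) * eps = 0 by rewrite mulrBl ee mul1r subrr.
have Q1e : Q (1 - eps) by exists 1%N; rewrite expr1.
pose F (J : B -> Prop) := [/\ forall b, exists a, J (b - g a), J (1 - eps)
  & forall x, J x -> Q x].
have [|J [iJ [JA J1e JQ] Jmin]] := minimal_ideal artB (F := F).
  by exists Q => //; split=> //; exact: su_residue.
have iQJ := prod_ideal_ideal Q J.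
(* [J0] is the image of the contraction of [Q], plus [Q J]. Since [Q] is that image plus [J], all
   products of two elements of [Q] fall in [J0], and unramifiedness gives that [Q] lies in [J0]. *)
pose J0 x := exists m y, [/\ Q (g m), prod_ideal Q J y & x = g m + y].
have QJ_Q y : prod_ideal Q J y -> Q y.
  by move=> /(_ Q iQ); apply=> q z Qq _; apply: (idealMr _ iQ).
have iJ0 : is_ideal J0.
  split.
  - exists 0, 0; rewrite rmorph0 addr0; split=> //; first by case: iQ.
    by case: iQJ.
  - move=> _ _ [m [y [Qm Jy ->]]] [m' [y' [Qm' Jy' ->]]]; exists (m + m'), (y + y').
    case: iQJ => _ D _; case: iQ => _ D' _.
    by rewrite rmorphD; split; [exact: D' | exact: D | ring].
  - move=> b _ [m [y [Qm Jy ->]]]; have [a Jb] := JA b.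
    exists (a * m), (g m * (b - g a) + b * y); rewrite rmorphM; split.
    + exact: (idealMl _ iQ).
    + case: (iQJ) => _ D _; apply: D; first exact: prod_idealM.
      exact: (idealMl _ iQJ).
    + ring.
have QE x : Q x -> exists m y, [/\ Q (g m), J y & x = g m + y].
  move=> Qx; have [a Ja] := JA x; exists a, (x - g a).
  split=> //; last by ring.
  have -> : g a = x - (x - g a) by ring.
  by apply: idealB => //; exact: JQ.
have QJ0 : forall x, Q x -> J0 x.
  apply: (su_unramified su pQ iJ0) => [x y Qx Qy|a Qa]; last first.
    by exists a, 0; split=> //; [case: iQJ | rewrite addr0].
  have [m [y1 [Qm Jy1 ex]]] := QE x Qx; have [m' [y2 [Qm' Jy2 ey]]] := QE y Qy.
  exists (m * m'), (g m * y2 + y * y1); rewrite rmorphM; split.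
  - exact: (idealMl _ iQ).
  - by case: (iQJ) => _ D _; apply: D; exact: prod_idealM.
  - rewrite ex ey; ring.
(* [Q J + (1 - eps) B] has the properties for which [J] is minimal, so it contains [J]; hence
   [J = Q J] on the component. *)
pose J' x := exists y b, prod_ideal Q J y /\ x = y + b * (1 - eps).
have JJ' : forall x, J x -> J' x.
  apply: Jmin.
  - split.
    + by exists 0, 0; rewrite mul0r addr0; split=> //; case: iQJ.
    + move=> _ _ [y [b [Qy ->]]] [z [c [Qz ->]]]; exists (y + z), (b + c).
      by split; [case: iQJ => _ D _; exact: D | ring].
    + move=> c _ [y [b [Qy ->]]]; exists (c * y), (c * b).
      by split; [exact: (idealMl _ iQJ) | ring].
  - split.
    + move=> b; have [a Qa] := su_residue su pQ b.
      have [m [y [Qm Jy ey]]] := QJ0 _ Qa.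
      exists (a + m), y, 0; split=> //.
      by rewrite rmorphD opprD addrA ey; ring.
    + by exists 0, 1; rewrite mul1r add0r; split=> //; case: iQJ.
    + move=> x [y [b [Jy ->]]]; case: iQ => _ D M; apply: D; first exact: QJ_Q.
      exact: M.
  - move=> x [y [b [Jy ->]]]; case: (iJ) => _ D M; apply: D; last exact: M.
    by apply: Jy => // q z _ Jz; exact: M.
suff Je : forall y, J y -> y * eps = 0.
  move=> b; have [a Ja] := JA b; exists a; apply/eqP; rewrite -subr_eq0 -mulrBl.
  by apply/eqP; exact: Je.
apply: contrapT => /existsNP[y0 /not_implyP[Jy0 ny0]].
(* Nakayama without generators of [J]: take [I] minimal with [I J eps] nonzero, witnessed by [x] in
   [I]. As [J = Q J] on [eps], the ideal [x Q] has the same property, so [x] lies in [x Q] and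
   [x * eps = 0]. *)
pose G (I : B -> Prop) := exists x y, [/\ I x, J y & x * y * eps <> 0].
have [|I [iI [x [y [Ix Jy nxy]]] Imin]] := minimal_ideal artB (F := G).
  by exists (fun=> True); [split | exists 1, y0; rewrite mul1r].
have ixQ : is_ideal (fun z => exists2 q, Q q & z = x * q).
  split.
  - by exists 0; [case: iQ | rewrite mulr0].
  - by move=> _ _ [q Qq ->] [r Qr ->]; exists (q + r); [case: iQ => _ D _; exact: D | ring].
  - by move=> c _ [q Qq ->]; exists (c * q); [exact: (idealMl _ iQ) | ring].
have [|z [q _ ->]|q Qq xq] := Imin _ ixQ _ _ x Ix.
- apply: contrapT => nG; apply: nxy.
  have iann : is_ideal (fun z => x * z * eps = 0).
    split=> [|u v xu xv|c u xu]; first by rewrite mulr0 mul0r.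
      by rewrite mulrDr mulrDl xu xv addr0.
    by rewrite mulrCA -mulrA xu mulr0.
  have [z [b [QJz ->]]] := JJ' _ Jy.
  have xz : x * z * eps = 0.
    apply: (QJz (fun z => x * z * eps = 0)) => // q z' Qq Jz'.
    apply: contrapT => nq; apply: nG; exists (x * q), z'.
    by split; [exists q | | rewrite -[x * q * z']mulrA].
  by rewrite mulrDr mulrDl xz -!mulrA eps0 !mulr0 addr0.
- exact: (idealMr _ iI).
- apply: nxy; rewrite mulrAC (nil_at_absorb Qq) ?mul0r //.
  by rewrite [q * x]mulrC -xq.
Qed.

Variables (I J : finType) (e : I -> A) (eps : J -> B).
Hypotheses (de : local_decomposition 1 e) (deps : local_decomposition 1 eps).

Let le i : local_idem (e i). Proof. by case: de. Qed.
Let leps j : local_idem (eps j). Proof. by case: deps. Qed.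

Lemma idem_epsE j l : eps j * eps l = if j == l then eps j else 0.
Proof.
have [<-|jl] := eqVneq j l; first by case: (leps j).
by case: deps => _ + _; apply.
Qed.

(** Some [g (e i)] is invertible on [eps j] because these elements sum to 1, and an invertible
    idempotent acts as the identity. *)
Lemma fiber_exists j : exists i, g (e i) * eps j = eps j.
Proof.
have [i ni] : exists i, ~ nil_at (eps j) (g (e i)).
  apply/existsNP => H; have [+ n1 _] := nil_at_prime (leps j); move=> iN; apply: n1.
  rewrite -(rmorph1 g); case: de => _ _ <-; rewrite rmorph_sum; exact: ideal_sum.
exists i; have [b ub] := notnil_unit (leps j) ni.
rewrite -{1}ub -[RHS]ub !mulrA -rmorphM.
by have [-> _ _] := le i.
Qed.

Variable p : J -> I.
Hypothesis pP : forall j, g (e (p j)) * eps j = eps j.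

Lemma g_idem_eps i j : g (e i) * eps j = if p j == i then eps j else 0.
Proof.
have [<-|pji] := eqVneq (p j) i; first exact: pP.
rewrite -(pP j) mulrA -rmorphM; case: de => _ oe _.
by rewrite oe 1?eq_sym // rmorph0 mul0r.
Qed.

Lemma g_idem_sum i : g (e i) = \sum_(j | p j == i) eps j.
Proof.
rewrite -[LHS]mulr1; case: deps => _ _ <-; rewrite mulr_sumr [RHS]big_mkcond.
by apply: eq_bigr => j _; exact: g_idem_eps.
Qed.

Lemma fiber_nonempty i : exists j, p j = i.
Proof.
apply: contrapT => H; have [_ /eqP + _] := le i; apply; apply: (su_inj su).
rewrite rmorph0 g_idem_sum big1 // => j /eqP pj; by case: H; exists j.
Qed.

(** If [j] were alone over its image, [g (e (p j))] would be [eps j]; as that factor of [B] comes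
    from [A], the idempotent [e (p j)] would lie in the zero conductor. *)
Lemma fiber_two j : exists2 j', j' != j & p j' = p j.
Proof.
apply: contrapT => H; have [_ /eqP + _] := le (p j); apply; apply: (su_conductor su).
move=> b; have gj : g (e (p j)) = eps j.
  rewrite g_idem_sum (big_pred1 j) // => l /=; apply/eqP/eqP => [pl|-> //].
  by apply: contrapT => /eqP lj; apply: H; exists l.
have [a ba] := component_generated (leps j) b.
by exists (a * e (p j)); rewrite rmorphM gj -ba mulrC.
Qed.

Lemma preim_nil_at j : same_set (Defs.preim g (nil_at (eps j))) (nil_at (e (p j))).
Proof.
move=> a; split=> [na|[k ak]]; last first.
  exists k; rewrite -rmorphXn -(pP j) mulrA -rmorphM ak rmorph0 mul0r //.
apply: contrapT => /(notnil_unit (le _))[b ab].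
apply: (unit_notnil (b := g b) (leps j)) na.
by rewrite -rmorphM -{1}(pP j) mulrA -rmorphM ab pP.
Qed.

(** A second factor over the same prime makes [su_faithful] available, and its multiplier [w] is
    invertible on [e (p j)]. With [component_generated], each factor of [B] is thus a copy of the
    factor of [A] below it. *)
Lemma g_eps_eq0 a j : g a * eps j = 0 <-> a * e (p j) = 0.
Proof.
split=> [ga|ae]; last by rewrite -(pP j) mulrA -rmorphM ae rmorph0 mul0r.
have [j' jj' pj'] := fiber_two j.
have [|||||w nw wa] := su_faithful su (Q := nil_at (eps j)) (Q' := nil_at (eps j')) _ _ _ _ ga.
- exact: nil_at_prime.
- exact: nil_at_prime.
- by move/(nil_at_inj deps) => ejj'; rewrite ejj' eqxx in jj'.
- move=> r; split=> /preim_nil_at nr; apply/preim_nil_at; last by rewrite -pj'.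
  by rewrite pj'.
- by apply: (unit_notnil (b := 1) (leps j)); rewrite mulr1; case: (leps j).
have [|c wc] := notnil_unit (le (p j)) (a := w).
  by move=> nwe; apply: nw; exact/preim_nil_at.
have -> : a * e (p j) = w * a * c * e (p j) by rewrite -{1}wc; ring.
by rewrite wa !mul0r.
Qed.

Lemma g_eps_inj a b j : g a * eps j = g b * eps j <-> a * e (p j) = b * e (p j).
Proof.
split=> /eqP; rewrite -subr_eq0 -mulrBl.
  by rewrite -rmorphB => /eqP/g_eps_eq0/eqP; rewrite mulrBl subr_eq0 => /eqP.
by move=> /eqP/g_eps_eq0/eqP; rewrite rmorphB mulrBl subr_eq0 => /eqP.
Qed.

End Components.

(** * Counting subalgebras *)

Section Subalgebras.
Variables (A B : comNzRingType) (g : {rmorphism A -> B}).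
Implicit Types T : B -> Prop.

Definition FIP_mod : Prop := fin_mod (is_subalgebra g) (@same_set B).

Lemma FIP_ext_mod : FIP_ext g <-> FIP_mod.
Proof.
split=> [[n [Ts TsP]]|fi].
  apply: (fin_mod_of_cover (t := Ts)) => // T T' U TU T'U x.
  by split=> [/TU/T'U|/T'U/TU].
by have [//|n [Ts TsP]] := fin_mod_family _ fi; exists n, Ts.
Qed.

Lemma subalgebra_sum T (K : Type) (s : seq K) (P : pred K) (F : K -> B) :
  is_subalgebra g T -> (forall k, P k -> T (F k)) -> T (\sum_(k <- s | P k) F k).
Proof.
by move=> [Tg TD _ _] TF; apply: big_ind => //; rewrite -(rmorph0 g); exact: Tg.
Qed.

Lemma subalgebra_prod T (K : Type) (s : seq K) (P : pred K) (F : K -> B) :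
  is_subalgebra g T -> (forall k, P k -> T (F k)) -> T (\prod_(k <- s | P k) F k).
Proof.
by move=> [Tg _ _ TM] TF; apply: big_ind => //; rewrite -(rmorph1 g); exact: Tg.
Qed.

Hypothesis su : split_unramified g.
Variables (I J : finType) (e : I -> A) (eps : J -> B).
Hypotheses (de : local_decomposition 1 e) (deps : local_decomposition 1 eps).
Variable p : J -> I.
Hypothesis pP : forall j, g (e (p j)) * eps j = eps j.

Let le i : local_idem (e i). Proof. by case: de. Qed.
Let leps j : local_idem (eps j). Proof. by case: deps. Qed.
Let epsE := idem_epsE deps.
Let g_inj := g_eps_inj su de deps pP.
Let epsM j : eps j * eps j = eps j. Proof. by case: (leps j). Qed.

(** This is [g(A) + Id B] in coordinates: all coordinates agree with one [a] modulo [Id]. *)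
Let sub_of (Id : A -> Prop) : B -> Prop := fun x =>
  exists a, forall j, exists2 c, Id c & x * eps j = g (a + c) * eps j.

Let sub_of_subalgebra Id : is_ideal Id -> is_subalgebra g (sub_of Id).
Proof.
move=> iI; have [I0 ID IM] := iI; split.
- by move=> r; exists r => j; exists 0; rewrite ?addr0.
- move=> x y [a xa] [b yb]; exists (a + b) => j.
  have [c Ic xc] := xa j; have [d Id' yd] := yb j.
  by exists (c + d); [exact: ID | rewrite mulrDl xc yd !rmorphD; ring].
- move=> x [a xa]; exists (- a) => j; have [c Ic xc] := xa j.
  by exists (- c); [exact: idealN | rewrite mulNr xc -opprD rmorphN mulNr].
- move=> x y [a xa] [b yb]; exists (a * b) => j.
  have [c Ic xc] := xa j; have [d Id' yd] := yb j.
  exists (a * d + (b + d) * c); first by apply: ID; exact: IM.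
  rewrite -(epsM j) mulrACA xc yd mulrACA -rmorphM; congr (g _ * _); ring.
Qed.

Lemma FIP_fin_ideals : FIP_mod -> fin_ideals A.
Proof.
suff sub I1 I2 : is_ideal I1 -> is_ideal I2 ->
    (forall x, sub_of I1 x -> sub_of I2 x) -> forall a, I1 a -> I2 a.
  apply: (fin_mod_comp (phi := sub_of)) => [I1|I1 I2 iI1 iI2 T12 a]; first exact: sub_of_subalgebra.
  by split; apply: sub => // x /T12.
move=> i1 i2 T12 a Ia.
suff Iai i : I2 (a * e i).
  by rewrite -[a]mulr1; case: de => _ _ <-; rewrite mulr_sumr; exact: ideal_sum.
have [j pj] := fiber_nonempty su de deps pP i.
have [j' jj' pj'] := fiber_two su de deps pP j.
(* The element with [a] at [j] and zero elsewhere lies in [g(A) + I1 B]. In [g(A) + I2 B], comparing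
   its coordinates at [j] and at the second index [j'] of the fiber puts [a * e i] into [I2]. *)
have [b xb] : sub_of I2 (g a * eps j).
  apply: T12; exists 0 => l; have [jl|jl] := eqVneq j l.
    by exists a => //; rewrite add0r -jl -mulrA epsM.
  exists 0; first by case: i1.
  by rewrite addr0 rmorph0 mul0r -mulrA epsE (negbTE jl) mulr0.
have [c Ic xc] := xb j; have [c' Ic' xc'] := xb j'.
have ac : a * e i = (b + c) * e i.
  by rewrite -pj; apply/g_inj; rewrite -xc -mulrA epsM.
have bc : 0 = (b + c') * e i.
  rewrite -[LHS](mul0r (e i)) -pj -pj'; apply/g_inj; rewrite -xc' rmorph0 mul0r.
  by rewrite -mulrA epsE eq_sym (negbTE jj') mulr0.
have -> : a * e i = (c - c') * e i.
  by rewrite -[LHS]subr0 bc ac; ring.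
by apply: (idealMr _ i2); exact: idealB.
Qed.

(* If [q] spans the socle of the SPIR [e_i A], the subalgebras
   [g(A) + g(A) q (eps_1 + u eps_2)] are distinct for [u] distinct modulo the
   maximal ideal: a third component forces the coefficient in [g(A)] to vanish. *)
Lemma FIP_two_components i : FIP_mod -> ~ component_finite (e i) ->
  (exists2 m, nil_at (e i) m & m * e i <> 0) ->
  (exists2 t, nil_at (e i) t &
     forall m, nil_at (e i) m -> exists a, m * e i = a * (t * e i)) ->
  forall j1 j2 j3, p j1 = i -> p j2 = i -> p j3 = i ->
  j1 != j2 -> j1 != j3 -> j2 != j3 -> False.
Proof.
move=> fip ninf [m nm m0] [t nt tP] j1 j2 j3 p1 p2 p3 n12 n13 n23; apply: ninf.
apply: (residue_finite_component (le i) (su_artA su) (FIP_fin_ideals fip)).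
have [ee e0 _] := le i.
(* [q] is the last nonzero power of the generator [t] on [e i]. The first vanishing exponent [k] is
   at least 2 as the maximal ideal is nonzero, so [2(k - 1) >= k] and [q] has square zero. *)
have [q [q0 qe qq]] : exists q, [/\ q <> 0, q * e i = q & q * q = 0].
  have ex : exists k, t ^+ k * e i == 0 by case: nt => k /eqP; exists k.
  case: (ex_minnP ex) => k /eqP tk kmin.
  have k2 : (1 < k)%N.
    case: k tk {kmin} => [|[|//]]; first by rewrite mul1r => /eqP; rewrite (negbTE e0).
    by rewrite expr1 => te0; case: m0; have [a ->] := tP m nm; rewrite te0 mulr0.
  exists (t ^+ k.-1 * e i); split.
  - by move=> /eqP/kmin; rewrite leqNgt prednK ?leqnn // ltnW.
  - by rewrite -mulrA ee.
  - rewrite mulrACA ee -exprD.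
    have -> : (k.-1 + k.-1 = k + k.-2)%N by case: k k2 {tk kmin} => [|[|k]] //= _; rewrite addnS addSn.
    by rewrite exprD mulrAC tk mul0r.
pose w u := eps j1 + g u * eps j2.
pose T u := fun x : B => exists r s, x = g r + g (s * q) * w u.
have Tsub u : is_subalgebra g (T u).
  split.
  - by move=> r; exists r, 0; rewrite mul0r rmorph0 mul0r addr0.
  - move=> _ _ [r [s ->]] [r' [s' ->]]; exists (r + r'), (s + s').
    by rewrite mulrDl !rmorphD; ring.
  - by move=> _ [r [s ->]]; exists (- r), (- s); rewrite mulNr !rmorphN; ring.
  - move=> _ _ [r [s ->]] [r' [s' ->]]; exists (r * r'), (r * s' + r' * s).
    have gqq : g q * g q = 0 by rewrite -rmorphM qq rmorph0.
    rewrite !(rmorphM, rmorphD).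
    have -> : (g r + g s * g q * w u) * (g r' + g s' * g q * w u)
       = g r * g r' + (g r * g s' + g r' * g s) * g q * w u
         + (g q * g q) * (g s * g s' * w u * w u) by ring.
    by rewrite gqq mul0r addr0.
apply: (fin_mod_comp (phi := T)) fip => // u v _ _ Tuv.
apply: contrapT => /(notnil_unit (le i))[c uc].
have /Tuv[r [s E]] : T u (g q * w u) by exists 0, 1; rewrite rmorph0 add0r mul1r.
(* [w u] and [w v] vanish at [j3], which kills [r]. The coordinate at [j1] then gives [q = s q], and
   the one at [j2] gives [q u = s q v = q v], impossible when [u - v] is invertible. *)
have E3 : r * e i = 0.
  rewrite -(mul0r (e i)) -p3; apply/g_inj; rewrite rmorph0 mul0r.
  have := congr1 (fun z => z * eps j3) E.
  rewrite mulrDl -!mulrA /w ![(_ + _ * _) * eps j3]mulrDl -!mulrA !epsE.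
  by rewrite (negbTE n13) (negbTE n23) !mulr0 !addr0 !mulr0 addr0 => <-.
have E1 : q = s * q.
  have : q * e i = (r + s * q) * e i.
    rewrite -p1; apply/g_inj; have := congr1 (fun z => z * eps j1) E.
    rewrite mulrDl -!mulrA /w ![(_ + _ * _) * eps j1]mulrDl -!mulrA !epsE.
    rewrite eqxx eq_sym in n12 *; rewrite (negbTE n12) !mulr0 !addr0 => ->.
    by rewrite rmorphD mulrDl.
  by rewrite mulrDl E3 add0r -mulrA qe.
have E2 : q * u = q * v.
  have : (q * u) * e i = (r + s * q * v) * e i.
    rewrite -p2; apply/g_inj; have := congr1 (fun z => z * eps j2) E.
    rewrite mulrDl -!mulrA /w ![(_ + _ * _) * eps j2]mulrDl -!mulrA !epsE.
    rewrite eqxx (negbTE n12) !add0r => E'.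
    rewrite rmorphD [s * (q * v)]mulrA (rmorphM g (s * q)) mulrDl -[g (s * q) * _ * _]mulrA -E'.
    by rewrite rmorphM mulrA.
  by rewrite mulrDl E3 add0r -E1 -!mulrA ![_ * e i]mulrC !mulrA qe.
apply: q0; rewrite -qe -uc.
have -> : q * ((u - v) * c * e i) = (q * u - q * v) * (c * e i) by ring.
by rewrite E2 subrr mul0r.
Qed.

Definition agree_at i T T' := forall x, T (g (e i) * x) <-> T' (g (e i) * x).

(** A subalgebra contains each [g (e i)], so it is the sum of its pieces inside the [g (e i) B]. *)
Lemma FIP_of_components :
  (forall i, fin_mod (is_subalgebra g) (agree_at i)) -> FIP_mod.
Proof.
move/fin_mod_all; apply: (fin_mod_comp (phi := id)) => // T T' sT sT' TT' x.
suff sub U U' : is_subalgebra g U -> is_subalgebra g U' ->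
    (forall i, agree_at i U U') -> U x -> U' x.
  by split; apply: sub => // i z; have := TT' i z; tauto.
move=> sU sU' UU' Ux; rewrite -[x]mul1r -(rmorph1 g).
case: de => _ _ <-; rewrite rmorph_sum mulr_suml.
apply: subalgebra_sum => // i _; apply/UU'.
by case: sU => Ug _ _ UM; exact: UM.
Qed.

Lemma coordinates x : exists a : J -> A, forall j, x * eps j = g (a j) * eps j.
Proof.
have /choice[a aP] : forall j, exists a, x * eps j = g a * eps j.
  by move=> j; exact: component_generated.
by exists a.
Qed.

Lemma component_eq i x y :
  (forall j, p j = i -> x * eps j = y * eps j) -> g (e i) * x = g (e i) * y.
Proof.
move=> xy; rewrite (g_idem_sum de deps pP) !mulr_suml; apply: eq_bigr => j /eqP pj.
by rewrite !(mulrC (eps j)) xy.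
Qed.

Lemma FIP_finite_component i : component_finite (e i) ->
  fin_mod (is_subalgebra g) (agree_at i).
Proof.
move=> [s sP]; have /choice[ca caP] := coordinates.
(* Indices of members of [s] are below [size s]; the successor only makes the ordinal type nonempty,
   as [inord] requires. *)
pose code x : {ffun J -> 'I_(size s).+1} := [ffun j => inord (index (ca x j * e i) s)].
have codeP x y : code x = code y -> g (e i) * x = g (e i) * y.
  move=> cxy; apply: component_eq => j pj; rewrite (caP x) (caP y); apply/g_inj; rewrite pj.
  have /(congr1 (fun h : {ffun J -> 'I_(size s).+1} => h j : nat)) := cxy.
  rewrite !ffunE !inordK ?ltnS ?index_size // => exy.
  by rewrite -(nth_index 0 (sP (ca x j))) exy nth_index.
exists {set {ffun J -> 'I_(size s).+1}},
  (fun T => [set k | `[< exists2 x, T x & code x = k >]]).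
suff sub T T' : is_subalgebra g T -> is_subalgebra g T' ->
    [set k | `[< exists2 x, T x & code x = k >]]
      = [set k | `[< exists2 x, T' x & code x = k >]] ->
    forall x, T (g (e i) * x) -> T' (g (e i) * x).
  by move=> T T' sT sT' TT' x; split; exact: sub.
move=> sT sT' /setP TT' x Tx.
have := TT' (code (g (e i) * x)); rewrite !inE => /esym.
have -> : `[< exists2 y, T y & code y = code (g (e i) * x) >].
  by apply/asboolP; exists (g (e i) * x).
move=> /asboolP[y T'y /codeP].
rewrite [in RHS]mulrA -rmorphM; have [-> _ _] := le i => <-.
by case: sT' => T'g _ _; apply.
Qed.

(** An element of the component with coordinates [a1], [a2] is [g (a2 * e i)], present in every
    subalgebra, plus [g (a1 - a2) * eps j1]. So [T] is determined by the ideal of those [a] with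
    [g a * eps j1] in [T]. *)
Lemma FIP_two_component i j1 j2 : fin_ideals A -> j1 != j2 -> p j1 = i -> p j2 = i ->
  (forall j, p j = i -> j = j1 \/ j = j2) ->
  fin_mod (is_subalgebra g) (agree_at i).
Proof.
move=> fiA n12 p1 p2 p12.
have ge : g (e i) = eps j1 + eps j2.
  rewrite (g_idem_sum de deps pP) (bigD1 j1) ?p1 //= (bigD1 j2) ?p2 ?eqxx /=; last by rewrite eq_sym.
  rewrite big1 ?addr0 // => j /andP[/andP[/eqP/p12[->|->]]]; by rewrite eqxx.
apply: (fin_mod_comp (phi := fun T a => T (g a * eps j1))) fiA.
  move=> T [Tg TD TN TM]; split.
  - by rewrite rmorph0 mul0r -(rmorph0 g).
  - by move=> a b Ta Tb; rewrite rmorphD mulrDl; exact: TD.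
  - by move=> a b Tb; rewrite rmorphM -mulrA; apply: TM.
suff sub T T' : is_subalgebra g T -> is_subalgebra g T' ->
    (forall a, T (g a * eps j1) -> T' (g a * eps j1)) ->
    forall x, T (g (e i) * x) -> T' (g (e i) * x).
  by move=> T T' sT sT' TT' x; split; apply: sub => // a; apply TT'.
move=> [Tg TD TN TM] [T'g T'D _ _] TT' x.
have [a aP] := coordinates x.
have -> : g (e i) * x = g (a j2 * e i) + g (a j1 - a j2) * eps j1.
  rewrite rmorphM rmorphB {2}ge ge mulrDl ![_ * x]mulrC !aP; ring.
move=> Tx; apply: (T'D) => //; apply: TT'.
have -> : g (a j1 - a j2) * eps j1
  = g (a j2 * e i) + g (a j1 - a j2) * eps j1 + - g (a j2 * e i) by ring.
by apply: TD => //; apply: TN.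
Qed.

(* Lagrange interpolation: a subalgebra of [k^n] is spanned by the idempotents it contains. *)
Lemma FIP_field_component i :
  (forall a, a * e i = 0 \/ exists b, a * b * e i = e i) ->
  fin_mod (is_subalgebra g) (agree_at i).
Proof.
move=> fld; pose idem (X : {set J}) := \sum_(j in X) eps j.
have idemE X m : idem X * eps m = if m \in X then eps m else 0.
  rewrite mulr_suml; case: ifPn => mX; last first.
    by apply: big1 => l lX; rewrite epsE; case: eqP => // lm; rewrite -lm lX in mX.
  rewrite (bigD1 m) //= epsM big1 ?addr0 // => l /andP[_ lm].
  by rewrite epsE (negbTE lm).
exists {set {set J}}, (fun T => [set X | `[< T (idem X) >]]).
suff sub T T' : is_subalgebra g T -> is_subalgebra g T' ->
    (forall X, T (idem X) -> T' (idem X)) ->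
    forall x, T (g (e i) * x) -> T' (g (e i) * x).
  move=> T T' sT sT' /setP TT' x; split; apply: sub => // X H;
    have := TT' X; rewrite !inE => TX; apply/asboolP.
    by rewrite -TX; apply/asboolP.
  by rewrite TX; apply/asboolP.
move=> sT sT' TT' x0; set x := g (e i) * x0 => Tx.
have [Tg TD TN TM] := sT; have [T'g T'D T'N T'M] := sT'.
have [ee _ _] := le i.
have [a aP] := coordinates x.
pose col j := a j * e i.
(* The level sets of [x] over [i]: the factors where its coordinate is [c]. *)
pose X c := [set l | (p l == i) && (col l == c)].
have colE m : p m = i -> x * eps m = g (col m) * eps m.
  by move=> pm; rewrite aP /col rmorphM -mulrA -pm pP.
have TX j : p j = i -> T (idem (X (col j))).
  move=> pj.
  have /choice[d dP] : forall l, exists d, col l != col j -> (col j - col l) * d * e i = e i.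
    move=> l; have [cl|cl] := eqVneq (col l) (col j); first by exists 0.
    case: (fld (col j - col l)) => [|[b ub]]; last by exists b.
    rewrite /col -mulrBl -mulrA ee mulrBl => /eqP; rewrite subr_eq0 => /eqP cjl.
    by rewrite /col cjl eqxx in cl.
  (* The Lagrange factor: it is 1 on the level set of [col j] and 0 on that of [col l]. *)
  pose F l := (x - g (col l)) * g (d l).
  suff <- : g (e i) * \prod_(l | (p l == i) && (col l != col j)) F l = idem (X (col j)).
    apply: (TM) => //; apply: subalgebra_prod => // l _; apply: (TM) => //.
    by apply: TD => //; exact: TN.
  apply: (decomp_eq deps) => m; rewrite idemE inE mulrAC (g_idem_eps de pP).
  case: (eqVneq (p m) i) => [pm|pm] /=; last by rewrite mul0r.
  rewrite mulrC; have [cm|cm] := eqVneq (col m) (col j).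
    apply: (big_ind (fun z => z * eps m = eps m)) => [|y z ym zm|l /andP[_ cl]].
    - by rewrite mul1r.
    - by rewrite -mulrA zm.
    - rewrite /F mulrAC mulrBl colE // cm -mulrBl -rmorphB mulrAC -rmorphM.
      by rewrite -{1}(pP m) mulrA -rmorphM pm dP // -{1}pm pP.
  rewrite (bigD1 m) /= ?pm ?eqxx //.
  have Fm : F m * eps m = 0 by rewrite /F mulrAC mulrBl colE // subrr mul0r.
  by rewrite mulrAC Fm mul0r.
(* Duplicates are removed so that each value of [x] contributes its level set once. *)
pose s := undup [seq col j | j <- enum J & p j == i].
have -> : x = \sum_(c <- s) g c * idem (X c).
  apply: (decomp_eq deps) => m; rewrite mulr_suml.
  under eq_bigr => c _ do rewrite -mulrA idemE inE.
  have [pm|pm] := eqVneq (p m) i; last first.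
    rewrite big1 => [|c _]; last by rewrite mulr0.
    by rewrite /x mulrAC (g_idem_eps de pP) (negbTE pm) mul0r.
  rewrite (bigD1_seq (col m)) ?undup_uniq //=; last first.
    by rewrite mem_undup; apply/mapP; exists m; rewrite // mem_filter pm eqxx mem_enum.
  rewrite eqxx colE // big1 ?addr0 // => c cm.
  by rewrite eq_sym (negbTE cm) mulr0.
rewrite big_seq_cond; apply: subalgebra_sum => // c /andP[+ _].
rewrite mem_undup => /mapP[j]; rewrite mem_filter => /andP[/eqP pj _] ->.
by apply: (T'M) => //; apply: TT'; exact: TX.
Qed.

End Subalgebras.

(** * The FIP criterion for a split unramified extension *)

Section CoreTheorem.
Variables (A B : comNzRingType) (g : {rmorphism A -> B}).
Hypothesis su : split_unramified g.

Lemma split_unramified_components : exists (I J : finType) (e : I -> A) (eps : J -> B) (p : J -> I),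
  [/\ local_decomposition 1 e, local_decomposition 1 eps
    & forall j, g (e (p j)) * eps j = eps j].
Proof.
have [I [e de]] := local_decomposition_idem (su_artA su) (mulr1 1).
have [J [eps deps]] := local_decomposition_idem (su_artB su) (mulr1 1).
have /choice[p pP] := fiber_exists g de deps.
by exists I, J, e, eps, p.
Qed.

Lemma split_unramified_two_primes (M : A -> Prop) : is_prime M ->
  exists Q1 Q2, [/\ is_prime Q1, is_prime Q2, ~ same_set Q1 Q2,
    same_set (Defs.preim g Q1) M & same_set (Defs.preim g Q2) M].
Proof.
have [I [J [e [eps [p [de deps pP]]]]]] := split_unramified_components.
move=> /(decomp_prime de)[i Mi].
have [j pj] := fiber_nonempty su de deps pP i.
have [j' jj' pj'] := fiber_two su de deps pP j.
have leps l : local_idem (eps l) by case: deps.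
have pre l : p l = i -> same_set (Defs.preim g (nil_at (eps l))) M.
  move=> pl a; have := preim_nil_at de deps pP l a; rewrite pl => H.
  by split=> [/H/Mi|/Mi/H].
exists (nil_at (eps j)), (nil_at (eps j')); split; try exact: nil_at_prime.
- by move/(nil_at_inj deps) => ejj'; rewrite ejj' eqxx in jj'.
- exact: pre.
- by apply: pre; rewrite pj'.
Qed.

Theorem split_unramified_FIP : FIP_ext g <->
  quotient_FMIR (fun x : A => x = 0) /\
  (forall M, is_prime M -> loc_SPIR M -> loc_infinite M -> two_primes_over g M).
Proof.
have [I [J [e [eps [p [de deps pP]]]]]] := split_unramified_components.
have le i : local_idem (e i) by case: de.
have leps l : local_idem (eps l) by case: deps.
rewrite FIP_ext_mod quotient_FMIR_fin_ideals.
have pre l (M : A -> Prop) : same_set M (nil_at (e (p l))) ->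
    same_set (Defs.preim g (nil_at (eps l))) M.
  move=> Ml a; have H := preim_nil_at de deps pP l a.
  by split=> [/H/Ml|/Ml/H].
have over (M : A -> Prop) i Q : same_set M (nil_at (e i)) -> is_prime Q ->
    same_set (Defs.preim g Q) M -> exists2 j, p j = i & same_set Q (nil_at (eps j)).
  move=> Mi /(decomp_prime deps)[j Qj] QM; exists j => //; apply: (nil_at_inj de) => a.
  have H := preim_nil_at de deps pP j a.
  by split=> [/H/Qj/QM/Mi|/Mi/QM/Qj/H].
split=> [fip|[fiA two]].
  split=> [|M pM spir inf]; first exact: (FIP_fin_ideals su de deps pP).
  have [i Mi] := decomp_prime de pM.
  have [nil0 princ] := (loc_SPIR_component (le i) Mi).1 spir.
  have ninf := (loc_infinite_component (le i) Mi).1 inf.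
  have [j1 p1] := fiber_nonempty su de deps pP i.
  have [j2 n21 p2] := fiber_two su de deps pP j1.
  exists (nil_at (eps j1)), (nil_at (eps j2)); split.
  - by split; [exact: nil_at_prime | apply: pre; rewrite p1].
  - by split; [exact: nil_at_prime | apply: pre; rewrite p2 p1].
  - by move/(nil_at_inj deps) => e12; rewrite e12 eqxx in n21.
  - move=> Q pQ /(over _ _ _ Mi pQ)[j pj Qj].
    have [e1|n1] := eqVneq j1 j; first by left; rewrite e1.
    have [e2|n2] := eqVneq j2 j; first by right; rewrite e2.
    rewrite p1 in p2; case: (FIP_two_components su de deps pP fip ninf nil0 princ p1 p2 pj) => //.
    by rewrite eq_sym.
apply: (FIP_of_components de) => i.
(* Three cases for the factor of [A]: finite, a field, or neither. In the last the residue field is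
   infinite, so the factor is an infinite SPIR and the hypothesis leaves exactly two factors of [B]
   above it. *)
have [fin|nfin] := pselect (component_finite (e i)).
  exact: (FIP_finite_component su de deps pP).
have [fld|nfld] := pselect (forall a, a * e i = 0 \/ exists b, a * b * e i = e i).
  exact: (FIP_field_component su de deps pP).
have M_i : same_set (nil_at (e i)) (nil_at (e i)) by [].
have [||Q1 [Q2 [[pQ1 M1] [pQ2 M2] n12 Q12]]] := two _ (nil_at_prime (le i)).
- apply/(loc_SPIR_component (le i) M_i); split.
    move/existsNP: nfld => [a /not_orP[ae0 aunit]]; exists a => //.
    by apply: contrapT => /(notnil_unit (le i)).
  apply: nil_at_principal => // rf; apply: nfin.
  exact: residue_finite_component (le i) (su_artA su) fiA rf.
- exact/(loc_infinite_component (le i) M_i).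
have [j1 p1 Qj1] := over _ _ _ M_i pQ1 M1; have [j2 p2 Qj2] := over _ _ _ M_i pQ2 M2.
apply: (FIP_two_component su de deps pP (j1 := j1) (j2 := j2)) => //.
  by apply/eqP => e12; apply: n12 => x; rewrite e12 in Qj1; have := Qj1 x; have := Qj2 x; tauto.
move=> j pj; have [||Qx|Qx] := Q12 (nil_at (eps j)).
- exact: nil_at_prime.
- by apply: pre; rewrite pj.
- left; apply: (nil_at_inj deps) => x; have := Qx x; have := Qj1 x; tauto.
- right; apply: (nil_at_inj deps) => x; have := Qx x; have := Qj2 x; tauto.
Qed.

End CoreTheorem.

(** * Finite, flat and unramified extensions *)

Section FiniteModule.
Variables (R S : comNzRingType) (f : {rmorphism R -> S}).

Definition submodule (V : S -> Prop) : Prop :=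
  [/\ V 0, forall x y, V x -> V y -> V (x + y) & forall r x, V x -> V (f r * x)].

Definition span (G : seq S) : S -> Prop := fun s =>
  forall V, submodule V -> (forall x, x \in G -> V x) -> V s.

Lemma span_submodule G : submodule (span G).
Proof.
split=> [V [] //|x y Gx Gy V sV GV|r x Gx V sV GV].
  by have [_ VD _] := sV; apply: VD; [exact: Gx | exact: Gy].
by have [_ _ VM] := sV; apply: VM; exact: Gx.
Qed.

Lemma mem_span G x : x \in G -> span G x.
Proof. by move=> xG V _; apply. Qed.

Lemma span_mull G G' y : (forall x, x \in G -> span G' (x * y)) ->
  forall s, span G s -> span G' (s * y).
Proof.
move=> H s /(_ (fun s => span G' (s * y))); apply=> //; have [V0 VD VM] := span_submodule G'; split.
- by rewrite mul0r.
- by move=> a b Va Vb; rewrite mulrDl; exact: VD.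
- by move=> r a Va; rewrite -mulrA; exact: VM.
Qed.

Lemma span_sum G (K : Type) (s : seq K) (P : pred K) (F : K -> S) :
  (forall k, P k -> span G (F k)) -> span G (\sum_(k <- s | P k) F k).
Proof. by have [V0 VD _] := span_submodule G; exact: (big_ind (span G)). Qed.

Lemma span_coordinates G s : span G s ->
  exists r : nat -> R, s = \sum_(j < size G) f (r j) * G`_j.
Proof.
move=> /(_ (fun s => exists r : nat -> R, s = \sum_(j < size G) f (r j) * G`_j)).
apply; first split.
- by exists (fun=> 0); rewrite big1 // => j _; rewrite rmorph0 mul0r.
- move=> x y [r ->] [r' ->]; exists (fun j => r j + r' j); rewrite -big_split.
  by apply: eq_bigr => j _; rewrite rmorphD mulrDl.
- move=> c x [r ->]; exists (fun j => c * r j); rewrite mulr_sumr.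
  by apply: eq_bigr => j _; rewrite rmorphM mulrA.
move=> x xG; exists (fun j => (j == index x G)%:R).
have ix : (index x G < size G)%N by rewrite index_mem.
rewrite (bigD1 (Ordinal ix)) //= eqxx rmorph1 mul1r nth_index // big1 ?addr0 // => j.
by rewrite -val_eqE /= => /negbTE->; rewrite rmorph0 mul0r.
Qed.

(** The monic equation is multiplied once by [y], which makes [D] positive without examining
    constant polynomials. *)
Lemma integral_power_span y : integral_ext f -> exists D, (0 < D)%N /\
  exists c : nat -> R, y ^+ D = \sum_(j < D) f (c j) * y ^+ j.
Proof.
move=> /(_ y)[P [monP /rootP rootP]].
have sP : (0 < size P)%N by rewrite size_poly_gt0 monic_neq0.
exists (size P); split=> //.
have [d eD] : exists d, size P = d.+1 by exists (size P).-1; rewrite prednK.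
have lc : P`_d = 1 by move/monicP: monP; rewrite lead_coefE eD.
have yd : y ^+ d = - \sum_(j < d) f P`_j * y ^+ j.
  move: rootP; rewrite (horner_coef_wide (n := d.+1)) -?eD ?size_poly // eD.
  rewrite big_ord_recr /= coef_map /= lc rmorph1 mul1r => /eqP.
  rewrite addrC addr_eq0 => /eqP ->; congr (- _).
  by apply: eq_bigr => j _; rewrite coef_map.
exists (fun j => if j is j'.+1 then - P`_j' else 0).
rewrite eD exprS yd big_ord_recl rmorph0 mul0r add0r mulrN mulr_sumr -sumrN.
by apply: eq_bigr => j _; rewrite /= rmorphN mulNr exprS mulrCA.
Qed.

(** Adjoining [y] replaces [G] by its products with the powers of [y] below [D]; the relation for
    [y ^+ D] keeps the span stable. *)
Lemma integral_span (xs : seq S) : integral_ext f -> exists G : seq S,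
  span G 1 /\ forall x, x \in xs -> forall y, y \in G -> span G (x * y).
Proof.
move=> intS; elim: xs => [|y xs [G [G1 Gxs]]].
  by exists [:: 1]; split=> //; apply: mem_span; exact: mem_head.
have [D [D0 [c yD]]] := integral_power_span y intS.
pose G' := [seq z * y ^+ j | z <- G, j <- iota 0 D]; exists G'.
have GG' j : (j < D)%N -> forall s, span G s -> span G' (s * y ^+ j).
  move=> jD; apply: span_mull => z zG; apply: mem_span.
  by apply: (allpairs_f (fun z j => z * y ^+ j)) => //; rewrite mem_iota add0n.
split; first by rewrite -[1]mulr1 -(expr0 y); exact: GG'.
have [_ _ VM] := span_submodule G'.
move=> x xy w /allpairsP[[z j] /= [zG]]; rewrite mem_iota add0n => /= jD ->.
move: xy; rewrite inE => /predU1P[->|xs_x]; last first.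
  by rewrite mulrA; apply: (GG' _ jD); exact: Gxs.
rewrite mulrCA -exprS; have [jD'|] := ltnP j.+1 D.
  exact: (GG' _ jD' _ (mem_span zG)).
move=> Dj; have -> : j.+1 = D by apply/eqP; rewrite eqn_leq jD Dj.
rewrite yD mulr_sumr; apply: span_sum => k _; rewrite mulrCA; apply: VM.
exact: (GG' _ (ltn_ord k) _ (mem_span zG)).
Qed.

Lemma module_finite : fin_pres_ext f -> integral_ext f ->
  exists n (x : nat -> S), forall s, exists r : nat -> R,
    s = \sum_(j < n) f (r j) * x j.
Proof.
move=> [n [x [surj _]]] intS.
have [G [G1 Gx]] := integral_span (codom x) intS.
exists (size G), (nth 0 G) => s; apply: span_coordinates.
have Gmul i s' : span G s' -> span G (x i * s').
  move=> Gs; rewrite mulrC; apply: span_mull Gs => z zG.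
  by rewrite mulrC; apply: Gx => //; exact: codom_f.
have GmulX i k s' : span G s' -> span G (x i ^+ k * s').
  by elim: k => [|k IH] Gs; rewrite ?mul1r // exprS -mulrA; apply: Gmul; exact: IH.
have [P <-] := surj s; have [_ _ VM] := span_submodule G.
apply: span_sum => m _; apply: VM.
suff : forall z, span G z -> span G (mpoly.mmap1 x m * z) by move=> /(_ 1 G1); rewrite mulr1.
apply: (big_ind (fun w => forall z, span G z -> span G (w * z))) => [z|v w vP wP z Gz|i _ z Gz].
- by rewrite mul1r.
- by rewrite -mulrA; apply: vP; exact: wP.
- exact: GmulX.
Qed.

(** A chain of ideals of [S] is controlled by [n] chains of leading-coefficient ideals of [R]. Once
    all of these are stationary, leading terms are cancelled one generator at a time. *)
Lemma artinian_module_finite n (x : nat -> S) : artinian R ->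
  (forall s, exists r : nat -> R, s = \sum_(j < n) f (r j) * x j) -> artinian S.
Proof.
move=> artR gen I iI Idec.
(* leading coefficients of the elements of the [k]-th ideal lying in the span of x_0, ..., x_i *)
pose L i k : R -> Prop := fun r => exists r' : nat -> R,
  I k (f r * x i + \sum_(j < i) f (r' j) * x j).
have iL i k : is_ideal (L i k).
  have [I0 ID IM] := iI k; split.
  - by exists (fun=> 0); rewrite rmorph0 mul0r big1 ?addr0 // => j _; rewrite mul0r.
  - move=> a b [r Ir] [r' Ir']; exists (fun j => r j + r' j).
    have := ID _ _ Ir Ir'; rewrite addrACA -mulrDl -rmorphD -big_split /=.
    by under eq_bigr => j _ do rewrite -mulrDl -rmorphD.
  - move=> a b [r Ir]; exists (fun j => a * r j).
    have := IM (f a) _ Ir; rewrite mulrDr mulrA -rmorphM mulr_sumr.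
    by under eq_bigr => j _ do rewrite mulrA -rmorphM.
have /choice[N NP] : forall i, exists N, forall k, (N <= k)%N -> same_set (L i k) (L i N).
  by move=> i; apply: artR => // k r [r' Ir]; exists r'; exact: Idec.
exists (\max_(i < n) N i) => k Nk; have dec := decreasing_leq Idec Nk.
have Lk i r : (i < n)%N -> L i (\max_(i < n) N i) r -> L i k r.
  move=> i_n; have Ni : (N i <= \max_(i < n) N i)%N.
    exact: (leq_bigmax_cond (Ordinal i_n)).
  by move=> /(NP i _ Ni) H; apply/NP => //; exact: leq_trans Nk.
move=> s; split=> [|Is]; first exact: dec.
suff H i : (i <= n)%N -> forall r : nat -> R,
    I (\max_(i < n) N i) (\sum_(j < i) f (r j) * x j) -> I k (\sum_(j < i) f (r j) * x j).
  by have [r es] := gen s; rewrite es; apply: H => //; rewrite -es.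
elim: i => [_ r _|i IH i_n r Ir]; first by rewrite big_ord0; case: (iI k).
have [|r' Ir'] := @Lk i (r i) i_n.
  by exists r; move: Ir; rewrite big_ord_recr addrC.
have [_ ID _] := iI k.
have -> : \sum_(j < i.+1) f (r j) * x j = f (r i) * x i + \sum_(j < i) f (r' j) * x j
    + \sum_(j < i) f (r j - r' j) * x j.
  rewrite big_ord_recr /= addrC -addrA -big_split /=; congr (_ + _).
  by apply: eq_bigr => j _; rewrite -mulrDl -rmorphD addrC subrK.
apply: ID => //; apply: (IH (ltnW i_n) (fun j => r j - r' j)).
have -> : \sum_(j < i) f (r j - r' j) * x j = \sum_(j < i.+1) f (r j) * x j
    - (f (r i) * x i + \sum_(j < i) f (r' j) * x j).
  rewrite big_ord_recr /= [X in X - _]addrC opprD addrACA subrr add0r -sumrB.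
  by apply: eq_bigr => j _; rewrite -mulrBl -rmorphB.
by apply: idealB => //; exact: dec.
Qed.

End FiniteModule.

(** * Consequences of unramifiedness and flatness at a prime *)

Section Etale.
Variables (R S : comNzRingType) (f : {rmorphism R -> S}).

(** Let [r s] in [R] represent [s] modulo [Q]. Then [s - f (r s)] modulo [J] is a derivation, as its
    defects are products of two elements of [Q] or images of [R] inside [Q]. It vanishes, so [x] in
    [Q] is congruent to [f (r x)], which is in [J]. *)
Lemma unramified_ideal (Q J : S -> Prop) : unramified_ext f -> is_prime Q ->
  (forall s, exists r, Q (s - f r)) -> is_ideal J ->
  (forall x y, Q x -> Q y -> J (x * y)) -> (forall r, Q (f r) -> J (f r)) ->
  forall x, Q x -> J x.
Proof.
move=> unr pQ /choice[r rP] iJ QQ QR x Qx; have iQ : is_ideal Q by case: pQ.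
have [J1|J1] := pselect (J 1); first by rewrite -[x]mulr1; exact: (idealMl _ iJ).
have [B [pi [_ kerpi]]] := ideal_quotient iJ J1.
have piE y z : J (y - z) -> pi y = pi z.
  by move=> /kerpi/eqP; rewrite rmorphB subr_eq0 => /eqP.
have JR a b : Q (f a - f b) -> J (f a - f b) by rewrite -rmorphB; exact: QR.
pose d s : restr_scalars pi := pi (s - f (r s)).
have dder : is_Rderivation f d.
  split=> [y z|y z|c y].
  - rewrite /d -(rmorphD pi); apply: piE.
    have -> : y + z - f (r (y + z)) - (y - f (r y) + (z - f (r z)))
      = f (r y + r z) - f (r (y + z)) by rewrite rmorphD; ring.
    apply: JR; rewrite rmorphD.
    have -> : f (r y) + f (r z) - f (r (y + z))
      = (y + z - f (r (y + z))) - (y - f (r y)) - (z - f (r z)) by ring.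
    by do 2!apply: idealB => //.
  - rewrite !restr_scaleE /d -!(rmorphM pi) -(rmorphD pi); apply: piE.
    have -> : y * z - f (r (y * z)) - (y * (z - f (r z)) + z * (y - f (r y)))
      = (f (r y * r z) - f (r (y * z))) - (y - f (r y)) * (z - f (r z)).
      by rewrite rmorphM; ring.
    apply: idealB => //; last exact: QQ.
    apply: JR; rewrite rmorphM.
    have -> : f (r y) * f (r z) - f (r (y * z)) = (y * z - f (r (y * z)))
      - (z * (y - f (r y)) + f (r y) * (z - f (r z))) by ring.
    apply: idealB => //; have [_ QD QM] := iQ.
    by apply: QD; exact: QM.
  - rewrite restr_scaleE /d -(rmorphM pi); apply: piE.
    have -> : f c * y - f (r (f c * y)) - f c * (y - f (r y))
      = f (c * r y) - f (r (f c * y)) by rewrite rmorphM; ring.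
    apply: JR; rewrite rmorphM.
    have -> : f c * f (r y) - f (r (f c * y))
      = (f c * y - f (r (f c * y))) - f c * (y - f (r y)) by ring.
    by apply: idealB => //; exact: (idealMl _ iQ).
have /kerpi Jx : pi (x - f (r x)) = 0 by exact: (unr _ _ dder).
have -> : x = (x - f (r x)) + f (r x) by ring.
have [_ JD _] := iJ; apply: JD => //; apply: QR.
have -> : f (r x) = x - (x - f (r x)) by ring.
exact: idealB.
Qed.

(** The equational criterion for the single relation writes [x] with coefficients that annihilate
    [r]; as [x] is outside [Q], so is one of them. *)
Lemma flat_annihilator (Q : S -> Prop) r x : flat_ext f -> is_prime Q ->
  f r * x = 0 -> ~ Q x -> exists2 w, ~ Q (f w) & w * r = 0.
Proof.
move=> flat pQ rx Qx; have iQ : is_ideal Q by case: pQ.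
have [|m [a [y [xE ra]]]] := flat 1%N (fun=> r) (fun=> x); first by rewrite big_ord1.
have [j Qj] : exists j, ~ Q (f (a ord0 j)).
  apply/existsNP => H; apply: Qx; rewrite (xE ord0); apply: ideal_sum => // j _.
  exact: (idealMr _ iQ).
by exists (a ord0 j) => //; have := ra j; rewrite big_ord1 mulrC.
Qed.

Lemma prime_separate (Q1 Q2 : S -> Prop) : ~ same_set Q1 Q2 ->
  (exists2 s, Q1 s & ~ Q2 s) \/ (exists2 s, Q2 s & ~ Q1 s).
Proof.
move=> /existsNP[s]; have [H1|H1] := pselect (Q1 s); have [H2|H2] := pselect (Q2 s).
- by case.
- by left; exists s.
- by right; exists s.
- by case.
Qed.

(* Since [c s = r] is a linear relation between [s] and [1], which are independent
   modulo [M], flatness makes [c] vanish locally at [M]; [w] is a Cramer determinant. *)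
Lemma flat_conductor (Q1 Q2 : S -> Prop) c : flat_ext f ->
  is_prime Q1 -> is_prime Q2 -> ~ same_set Q1 Q2 ->
  same_set (Defs.preim f Q1) (Defs.preim f Q2) ->
  (forall s, exists r, Q1 (s - f r)) -> (forall s, exists r, Q2 (s - f r)) ->
  conductor f c -> exists2 w, ~ Q1 (f w) & w * c = 0.
Proof.
move=> flat pQ1 pQ2 n12 e12 res1 res2 Cc.
wlog [s Q1s Q2s] : Q1 Q2 pQ1 pQ2 n12 e12 res1 res2 / exists2 s, Q1 s & ~ Q2 s.
  move=> H; have [|[s Q2s Q1s]] := prime_separate n12; first exact: H.
  have [|||w Qw wc] := H Q2 Q1 pQ2 pQ1 _ _ res2 res1.
  - by move=> e21; apply: n12 => x; have := e21 x; tauto.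
  - by move=> r; have := e12 r; tauto.
  - by exists s.
  - by exists w => // /e12.
have i1 : is_ideal Q1 by case: pQ1.
have i2 : is_ideal Q2 by case: pQ2.
have [r rE] := Cc s.
have [|m [a [y [yE aE]]]] := flat 2%N (fun i => if val i == 0%N then c else - r)
    (fun i => if val i == 0%N then s else 1).
  by rewrite !big_ord_recl big_ord0 /= -rE rmorphN mulr1 addr0 subrr.
(* [eta] and [theta] lift to [R] the values of the [y j] in the residue fields of [Q1] and [Q2]. *)
have /choice[eta etaP] : forall j, exists t, Q1 (y j - f t) by move=> j; exact: res1.
have /choice[theta thetaP] : forall j, exists t, Q2 (y j - f t) by move=> j; exact: res2.
have sE := yE ord0; have oneE := yE (lift ord0 ord0); rewrite /= in sE oneE.
pose al j := a ord0 j; pose be j := a (lift ord0 ord0) j.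
have ab j : c * al j = r * be j.
  have := aE j; rewrite !big_ord_recl big_ord0 /= addr0 mulNr => /eqP.
  by rewrite subr_eq0 => /eqP.
have ev (Q : S -> Prop) (t : 'I_m -> R) (b : 'I_m -> R) : is_ideal Q ->
    (forall j, Q (y j - f (t j))) ->
    Q (\sum_(j < m) f (b j) * y j - f (\sum_(j < m) b j * t j)).
  move=> iQ Qt; rewrite rmorph_sum -sumrB; apply: ideal_sum => // j _.
  by rewrite rmorphM -mulrBr; exact: (idealMl _ iQ).
have e1 := ev _ _ al i1 etaP; have e2 := ev _ _ be i1 etaP.
have e3 := ev _ _ al i2 thetaP; rewrite -sE in e1 e3; rewrite -oneE in e2.
set ae := \sum_(j < m) al j * eta j in e1; set b_e := \sum_(j < m) be j * eta j in e2.
set at_ := \sum_(j < m) al j * theta j in e3.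
pose bt := \sum_(j < m) be j * theta j.
have cae : c * ae = r * b_e by rewrite !mulr_sumr; apply: eq_bigr => j _; rewrite !mulrA ab.
have cat_ : c * at_ = r * bt by rewrite !mulr_sumr; apply: eq_bigr => j _; rewrite !mulrA ab.
have Qae : Q1 (f ae).
  have -> : f ae = s - (s - f ae) by ring.
  exact: idealB.
have nbe : ~ Q1 (f b_e).
  move=> Qb; case: (pQ1) => _ + _; apply.
  have -> : 1 = (1 - f b_e) + f b_e by ring.
  by case: i1 => _ D _; exact: D.
have nat_ : ~ Q1 (f at_).
  move=> /e12 Qa; apply: Q2s; have -> : s = (s - f at_) + f at_ by ring.
  by case: i2 => _ D _; exact: D.
(* The rows of this determinant are the values of [s] and [1] at the two primes. Modulo [Q1] it
   reduces to [at_ * b_e], both factors being outside [Q1]. *)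
exists (at_ * b_e - ae * bt); last first.
  have -> : (at_ * b_e - ae * bt) * c = (c * at_) * b_e - (c * ae) * bt by ring.
  by rewrite cae cat_; ring.
rewrite rmorphB !rmorphM => QD.
have : Q1 (f at_ * f b_e).
  have -> : f at_ * f b_e = (f at_ * f b_e - f ae * f bt) + f bt * f ae by ring.
  by case: (i1) => _ D M; apply: D => //; exact: M.
by case: pQ1 => _ _ PM /PM[].
Qed.

End Etale.

(** * Passage to the nucleus *)

Section Surjection.
Variables (R A : comNzRingType) (pi : {rmorphism R -> A}).
Hypothesis pi_surj : forall a, exists r, pi r = a.

Definition push (P : R -> Prop) : A -> Prop := fun a => exists2 r, P r & pi r = a.

Lemma preim_ideal (I : A -> Prop) : is_ideal I -> is_ideal (Defs.preim pi I).
Proof.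
move=> [I0 ID IM]; split; rewrite /Defs.preim.
- by rewrite rmorph0.
- by move=> x y Ix Iy; rewrite rmorphD; exact: ID.
- by move=> a x Ix; rewrite rmorphM; exact: IM.
Qed.

Lemma preim_prime (P : A -> Prop) : is_prime P -> is_prime (Defs.preim pi P).
Proof.
move=> [iP P1 PM]; split; first exact: preim_ideal.
  by rewrite /Defs.preim rmorph1.
by move=> x y; rewrite /Defs.preim rmorphM => /PM.
Qed.

Lemma pushE (P : R -> Prop) r : (forall x y, P x -> P y -> P (x + y)) ->
  (forall x, pi x = 0 -> P x) -> push P (pi r) <-> P r.
Proof.
move=> PD P0; split=> [[r' Pr' e]|Pr]; last by exists r.
have -> : r = r' + (r - r') by ring.
by apply: PD => //; apply: P0; rewrite rmorphB e subrr.
Qed.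

Lemma push_ideal (I : R -> Prop) : is_ideal I -> is_ideal (push I).
Proof.
move=> [I0 ID IM]; split; first by exists 0; rewrite ?rmorph0.
- by move=> _ _ [x Ix <-] [y Iy <-]; exists (x + y); rewrite ?rmorphD //; exact: ID.
- move=> a _ [x Ix <-]; have [b <-] := pi_surj a.
  by exists (b * x); rewrite ?rmorphM //; exact: IM.
Qed.

Lemma push_idealE (I : R -> Prop) r : is_ideal I -> (forall x, pi x = 0 -> I x) ->
  push I (pi r) <-> I r.
Proof. by move=> [_ ID _]; exact: pushE. Qed.

Lemma push_prime (P : R -> Prop) : is_prime P -> (forall x, pi x = 0 -> P x) ->
  is_prime (push P).
Proof.
move=> [iP P1 PM] P0; split; first exact: push_ideal.
  by rewrite -(rmorph1 pi) => /(push_idealE _ iP P0).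
move=> a b; have [x <-] := pi_surj a; have [y <-] := pi_surj b.
rewrite -rmorphM => /(push_idealE _ iP P0)/PM[Px|Py]; [left|right].
  exact/push_idealE.
exact/push_idealE.
Qed.

Lemma quotient_FMIR_surj (C : R -> Prop) : (forall r, pi r = 0 <-> C r) ->
  quotient_FMIR C <-> quotient_FMIR (fun a : A => a = 0).
Proof.
move=> ker; split=> -[n [Is IsP]].
  exists n, (fun i => push (Is i)) => I [iI _].
  have [|i Ii] := IsP (Defs.preim pi I).
    split; first exact: preim_ideal.
    by move=> x /ker; rewrite /Defs.preim => ->; case: iI.
  exists i => a; split=> [Ia|[r /Ii Ir <-] //].
  by have [r ra] := pi_surj a; exists r => //; apply/Ii; rewrite /Defs.preim ra.
exists n, (fun i => Defs.preim pi (Is i)) => I [iI CI].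
have kI x : pi x = 0 -> I x by move=> /ker/CI.
have [|i Ii] := IsP (push I).
  by split; [exact: push_ideal | move=> x ->; case: (push_ideal iI)].
exists i => r; split=> [Ir|Ir]; first by apply/Ii; exists r.
by apply/(push_idealE _ iI kI); apply/Ii.
Qed.

Lemma quotient_artinian_surj (C : R -> Prop) : (forall r, pi r = 0 <-> C r) ->
  quotient_artinian C -> artinian A.
Proof.
move=> ker artC I iI Idec.
have [k|k x|N NP] := artC (fun k => Defs.preim pi (I k)).
- split; first exact: preim_ideal.
  by move=> x /ker; rewrite /Defs.preim => ->; case: (iI k).
- exact: Idec.
by exists N => k Nk a; have [r <-] := pi_surj a; exact: NP.
Qed.

Section Localization.
Variables (M : R -> Prop) (N : A -> Prop).
Hypothesis MN : forall r, M r <-> N (pi r).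
Hypothesis primeM : is_prime M.
Hypothesis kill : forall c, pi c = 0 -> exists2 w, ~ M w & w * c = 0.

(** By [kill] the kernel of [pi] vanishes after localizing at [M], so the localizations at [M] and
    at [N] are the same ring. *)
Lemma loc_eq_surj a u b v : loc_eq M a u b v <-> loc_eq N (pi a) (pi u) (pi b) (pi v).
Proof.
split=> [[w [Mw wz]]|[w [Nw wz]]].
  exists (pi w); split; first by move/MN.
  by rewrite -!rmorphM -rmorphB -rmorphM wz rmorph0.
have [r rw] := pi_surj w; rewrite -rw -!rmorphM -rmorphB -rmorphM in wz.
have [t Mt tz] := kill wz; exists (t * r); split; last by rewrite -mulrA.
by case: primeM => _ _ PM /PM[//|/MN]; rewrite rw.
Qed.

Lemma loc_infinite_surj : loc_infinite M <-> loc_infinite N.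
Proof.
split=> inf n a u Nu; last first.
  have [i|b [v [Nv bv]]] := inf n (pi \o a) (pi \o u); first by move/MN; exact: Nu.
  have [b' eb] := pi_surj b; have [v' ev] := pi_surj v.
  exists b', v'; split; first by move/MN; rewrite ev.
  by move=> i /loc_eq_surj; rewrite eb ev; exact: bv.
have /choice[a' aP] := fun i => pi_surj (a i).
have /choice[u' uP] := fun i => pi_surj (u i).
have [i|b [v [Nv bv]]] := inf n a' u'; first by move/MN; rewrite uP; exact: Nu.
exists (pi b), (pi v); split; first by move/MN.
by move=> i; rewrite -aP -uP => /loc_eq_surj; exact: bv.
Qed.

Lemma loc_SPIR_surj : loc_SPIR M <-> loc_SPIR N.
Proof.
have p1 : pi 1 = 1 by exact: rmorph1.
have p0 : pi 0 = 0 by exact: rmorph0.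
split=> [[[m [Mm m0]] [p [n [Mp [pP pn]]]]]|[[m [Nm m0]] [p [n [Np [pP pn]]]]]].
  split; first by exists (pi m); split; [exact/MN | rewrite -p1 -p0 => /loc_eq_surj].
  exists (pi p), n; split; first exact/MN.
  split; last by rewrite -p1 -p0 -rmorphXn; exact/loc_eq_surj.
  move=> m'; have [m1 <-] := pi_surj m' => /MN/pP[a [u [Mu e]]].
  exists (pi a), (pi u); split; first by move/MN.
  by rewrite -p1 -rmorphM; exact/loc_eq_surj.
have [m' em] := pi_surj m; have [p' ep] := pi_surj p.
split.
  exists m'; split; first by apply/MN; rewrite em.
  by move/loc_eq_surj; rewrite em p1 p0.
exists p', n; split; first by apply/MN; rewrite ep.
split; last by apply/loc_eq_surj; rewrite rmorphXn ep p1 p0.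
move=> m1 /MN/pP[a [u [Nu e]]]; have [a' ea] := pi_surj a; have [u' eu] := pi_surj u.
exists a', u'; split; first by move/MN; rewrite eu.
by apply/loc_eq_surj; rewrite p1 rmorphM ea ep eu.
Qed.

End Localization.
End Surjection.

(** * The conductor square and the descent of the theorem *)

Section ConductorSquare.
Variables (R S : comNzRingType) (f : {rmorphism R -> S}).

Lemma conductor_ideal : is_ideal (conductor f).
Proof.
split.
- by move=> s; exists 0; rewrite rmorph0 mul0r.
- move=> x y Cx Cy s; have [a ea] := Cx s; have [b eb] := Cy s.
  by exists (a + b); rewrite !rmorphD mulrDl ea eb.
- move=> a x Cx s; have [b eb] := Cx s.
  by exists (a * b); rewrite !rmorphM eb mulrA.
Qed.

(** The conductor is an ideal of [S] too, which gives meaning to the quotient of [S] by it. *)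
Lemma push_conductor_ideal : is_ideal (push f (conductor f)).
Proof.
have [C0 CD CM] := conductor_ideal; split; first by exists 0; rewrite ?rmorph0.
- by move=> _ _ [x Cx <-] [y Cy <-]; exists (x + y); rewrite ?rmorphD //; exact: CD.
- move=> s _ [c Cc <-]; have [r er] := Cc s.
  exists r; last by rewrite er mulrC.
  by move=> t; have [r' er'] := Cc (s * t); exists r'; rewrite er er' mulrA.
Qed.

Lemma conductor1_surj : conductor f 1 -> forall s, exists r, f r = s.
Proof. by move=> C1 s; have [r er] := C1 s; exists r; rewrite er rmorph1 mul1r. Qed.

(* Two primes over [M] are separated by some [s], and [u s] in [f(R)] forces [u] in [M]. *)
Lemma two_primes_in_supp (M : R -> Prop) (Q1 Q2 : S -> Prop) :
  is_prime Q1 -> is_prime Q2 -> ~ same_set Q1 Q2 ->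
  same_set (Defs.preim f Q1) M -> same_set (Defs.preim f Q2) M ->
  is_prime M -> in_supp f M.
Proof.
move=> pQ1 pQ2 n12 M1 M2 pM; split=> //.
wlog [s Q1s Q2s] : Q1 Q2 pQ1 pQ2 n12 M1 M2 / exists2 s, Q1 s & ~ Q2 s.
  move=> H; have [|sep] := prime_separate n12; first exact: H.
  by apply: (H Q2 Q1) => // e21; apply: n12 => x; have := e21 x; tauto.
exists s => u Mu [r er]; have i1 : is_ideal Q1 by case: pQ1.
have : Q1 (f r) by rewrite er; exact: (idealMl _ i1).
move=> /M1/M2; rewrite /Defs.preim er; case: pQ2 => _ _ PM /PM[/M2 //|//].
Qed.

Lemma in_supp_conductor (M : R -> Prop) : in_supp f M -> forall c, conductor f c -> M c.
Proof. by move=> [_ [s sM]] c Cc; apply: contrapT => /sM; apply; exact: Cc. Qed.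

Hypotheses (finj : injective f) (etf : etale_ext f) (inff : infra_integral_ext f)
  (gilf : Gilmer_ext f).
Variables (A B : comNzRingType) (piA : {rmorphism R -> A}) (piB : {rmorphism S -> B}).
Variable g : {rmorphism A -> B}.
Hypotheses (surjA : forall a, exists r, piA r = a) (kerA : forall r, piA r = 0 <-> conductor f r).
Hypotheses (surjB : forall b, exists s, piB s = b)
  (kerB : forall s, piB s = 0 <-> push f (conductor f) s).
Hypothesis gE : forall r, g (piA r) = piB (f r).

Let artA : artinian A. Proof. exact: quotient_artinian_surj gilf. Qed.

(** Infra-integrality gives a fraction [a / b]; primes of the Artinian ring [A] are maximal, so [b]
    has an inverse [c'] modulo [Q] coming from [R]. *)
Lemma residue_surj (Q : B -> Prop) : is_prime Q ->
  forall s, exists r, Defs.preim piB Q (s - f r).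
Proof.
move=> pQ s; have pQ' := preim_prime piB pQ; have [_ res] := inff.
have iQ : is_ideal Q by case: pQ.
have [|a [b [nb Qb]]] := res _ pQ' s 1; first by case: pQ'.
have [|c] := prime_maximal artA (preim_prime g pQ) (b := piA b).
  by rewrite /Defs.preim gE.
have [c' <-] := surjA c; rewrite -(rmorph1 piA) -rmorphM -rmorphB /Defs.preim gE => Qc.
exists (c' * a); rewrite /Defs.preim.
have -> : s - f (c' * a) = f (1 - b * c') * s + f c' * (f b * s - f a * 1).
  by rewrite !(rmorphB, rmorphM, rmorph1); ring.
rewrite rmorphD !rmorphM; have [_ QD _] := iQ; apply: QD; first exact: (idealMr _ iQ).
exact: (idealMl _ iQ).
Qed.

Lemma conductor_killed (Q1 Q2 : B -> Prop) c :
  is_prime Q1 -> is_prime Q2 -> ~ same_set Q1 Q2 ->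
  same_set (Defs.preim g Q1) (Defs.preim g Q2) -> conductor f c ->
  exists2 w, ~ Q1 (g (piA w)) & w * c = 0.
Proof.
move=> pQ1 pQ2 n12 e12 Cc; have [flat _ _] := etf.
have [||w Qw wc] := flat_conductor flat (preim_prime piB pQ1) (preim_prime piB pQ2)
  _ _ (residue_surj pQ1) (residue_surj pQ2) Cc.
- by move=> H; apply: n12 => b; have [s <-] := surjB b; exact: H.
- by move=> r; rewrite /Defs.preim -gE; exact: e12.
- by exists w => //; rewrite gE.
Qed.

Lemma nucleus_split_unramified : split_unramified g.
Proof.
have [flat fp unr] := etf; have [intf _] := inff; split.
- suff g0 a : g a = 0 -> a = 0.
    move=> a b /eqP; rewrite -subr_eq0 -rmorphB => /eqP/g0/eqP.
    by rewrite subr_eq0 => /eqP.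
  have [r <-] := surjA a; rewrite gE => /kerB[c Cc /finj rc].
  by apply/kerA; rewrite -rc.
- exact: artA.
- have [n [x xP]] := module_finite fp intf.
  apply: (artinian_module_finite (f := g) (n := n) (x := piB \o x) artA) => b.
  have [s <-] := surjB b; have [r ->] := xP s; exists (piA \o r).
  by rewrite rmorph_sum; apply: eq_bigr => j _; rewrite rmorphM -gE.
- move=> a; have [r <-] := surjA a => Cr; apply/kerA => s.
  have [a'] := Cr (piB s); have [r' <-] := surjA a'; rewrite !gE -rmorphM => /eqP.
  rewrite -subr_eq0 -rmorphB => /eqP/kerB[c _ ec].
  by exists (r' - c); rewrite rmorphB ec; ring.
- move=> Q pQ b; have [s <-] := surjB b; have [r] := residue_surj pQ s.
  by rewrite /Defs.preim rmorphB -gE; exists (piA r).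
- move=> Q pQ J iJ QQ QR b; have [s <-] := surjB b => Qs.
  apply: (unramified_ideal (f := f) (J := Defs.preim piB J) unr (preim_prime piB pQ)) Qs.
  + exact: residue_surj.
  + exact: preim_ideal.
  + by move=> x y Qx Qy; rewrite /Defs.preim rmorphM; exact: QQ.
  + by move=> r; rewrite /Defs.preim -gE; exact: QR.
- move=> Q Q' pQ pQ' nQ eQ a x; have [r <-] := surjA a; have [s <-] := surjB x.
  rewrite gE -rmorphM => /kerB[c Cc ec] Qs.
  (* The relation in [B] lifts to one in [S] up to a conductor element [c]; multiplying by [w]
     removes [c], and flatness applies to what remains. *)
  have [w Qw wc] := conductor_killed pQ pQ' nQ eQ Cc.
  have [|v Qv vwr] := flat_annihilator (r := w * r) (x := s) flat (preim_prime piB pQ) _ Qs.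
    by rewrite rmorphM -mulrA -ec -rmorphM wc rmorph0.
  exists (piA (v * w)); last by rewrite -rmorphM -mulrA vwr rmorph0.
  rewrite !rmorphM; case: pQ => _ _ PM /PM[|//].
  by rewrite gE; exact: Qv.
Qed.

(** Every subalgebra contains [f(R)], hence the kernel of [piB], so subalgebras of [S] and of [B]
    correspond. *)
Lemma FIP_ext_nucleus : FIP_ext f <-> FIP_ext g.
Proof.
split=> -[n [Ts TsP]].
  exists n, (fun i => push piB (Ts i)) => T [Tg TD TN TM].
  have [|i Ti] := TsP (fun s => T (piB s)).
    split=> [r|x y Tx Ty|x Tx|x y Tx Ty]; first by rewrite -gE.
    - by rewrite rmorphD; exact: TD.
    - by rewrite rmorphN; exact: TN.
    - by rewrite rmorphM; exact: TM.
  exists i => b; split=> [Tb|[s /Ti Ts' <-] //].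
  by have [s es] := surjB b; exists s => //; apply/Ti; rewrite es.
exists n, (fun i s => Ts i (piB s)) => T [Tf TD TN TM].
have T0 x : piB x = 0 -> T x by move=> /kerB[c _ <-].
have [|i Ti] := TsP (push piB T).
  split.
  - by move=> a; have [r <-] := surjA a; rewrite gE; exists (f r).
  - by move=> _ _ [x Tx <-] [y Ty <-]; exists (x + y); rewrite ?rmorphD //; exact: TD.
  - by move=> _ [x Tx <-]; exists (- x); rewrite ?rmorphN //; exact: TN.
  - by move=> _ _ [x Tx <-] [y Ty <-]; exists (x * y); rewrite ?rmorphM //; exact: TM.
by exists i => s; split=> [Ts'|/Ti/(pushE _ TD T0) //]; apply/Ti; exists s.
Qed.

Lemma two_primes_over_nucleus (M : R -> Prop) (N : A -> Prop) :
  (forall r, M r <-> N (piA r)) -> is_ideal N ->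
  two_primes_over f M <-> two_primes_over g N.
Proof.
move=> MN iN.
have lie (Q : B -> Prop) : same_set (Defs.preim f (Defs.preim piB Q)) M <->
    same_set (Defs.preim g Q) N.
  split=> H; last by move=> r; rewrite /Defs.preim -gE MN; exact: H.
  by move=> a; have [r <-] := surjA a; rewrite /Defs.preim gE -MN; exact: H.
have contains (Q : S -> Prop) : is_prime Q -> same_set (Defs.preim f Q) M ->
    forall s, piB s = 0 -> Q s.
  move=> _ QM s /kerB[c Cc <-]; apply/QM/MN; have /kerA -> := Cc.
  by case: iN.
have pushP (Q : S -> Prop) : is_prime Q -> same_set (Defs.preim f Q) M ->
    [/\ is_prime (push piB Q), forall s, push piB Q (piB s) <-> Q s
      & same_set (Defs.preim g (push piB Q)) N].
  move=> pQ QM; have cQ := contains Q pQ QM.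
  have E s : push piB Q (piB s) <-> Q s by apply: push_idealE => //; case: pQ.
  split=> //; first exact: push_prime.
  by apply/lie => r; rewrite /Defs.preim E; exact: QM.
split=> -[Q1 [Q2 [[pQ1 M1] [pQ2 M2] n12 Q12]]].
  have [p1 E1 l1] := pushP _ pQ1 M1; have [p2 E2 l2] := pushP _ pQ2 M2.
  exists (push piB Q1), (push piB Q2); split=> //.
    by move=> H; apply: n12 => s; rewrite -E1 -E2; exact: H.
  move=> Q pQ /lie QN; have [H|H] := Q12 _ (preim_prime piB pQ) QN; [left|right];
    move=> b; have [s <-] := surjB b.
    by rewrite E1; exact: H.
  by rewrite E2; exact: H.
exists (Defs.preim piB Q1), (Defs.preim piB Q2); split.
- by split; [exact: preim_prime | exact/lie].
- by split; [exact: preim_prime | exact/lie].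
- by move=> H; apply: n12 => b; have [s <-] := surjB b; exact: H.
move=> Q pQ QM; have [pQ' E l] := pushP _ pQ QM.
by have [H|H] := Q12 _ pQ' l; [left|right] => s; rewrite -E; exact: H.
Qed.

(** Primes in the support contain the conductor and so come from [A]. Conversely every prime of [A]
    has two primes of [B] above it, which places its preimage in the support and makes the conductor
    vanish in the localization there. *)
Lemma FIP_nucleus : FIP_ext f <->
  quotient_FMIR (conductor f) /\
  (forall M : R -> Prop, in_supp f M -> loc_SPIR M -> loc_infinite M ->
     two_primes_over f M).
Proof.
have su := nucleus_split_unramified.
rewrite FIP_ext_nucleus (split_unramified_FIP su) (quotient_FMIR_surj surjA kerA).
have kill (M : R -> Prop) (N : A -> Prop) : (forall r, M r <-> N (piA r)) ->
    is_prime N -> forall c, piA c = 0 -> exists2 w, ~ M w & w * c = 0.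
  move=> MN pN c /kerA Cc.
  have [Q1 [Q2 [pQ1 pQ2 n12 l1 l2]]] := split_unramified_two_primes su pN.
  have [|w Qw wc] := conductor_killed pQ1 pQ2 n12 _ Cc.
    by move=> a; have := l1 a; have := l2 a; tauto.
  by exists w => // /MN Nw; apply: Qw; exact/l1.
split=> -[fm two]; split=> //.
  move=> M sM; have [pM _] := sM; have iM : is_ideal M by case: pM.
  have cM x : piA x = 0 -> M x by move=> /kerA; exact: in_supp_conductor.
  have MN r : M r <-> push piA M (piA r) by rewrite (push_idealE _ iM cM).
  have pN := push_prime surjA pM cM; have k := kill _ _ MN pN.
  move=> /(loc_SPIR_surj surjA MN pM k) sp /(loc_infinite_surj surjA MN pM k) li.
  by apply/(two_primes_over_nucleus MN) => //; [case: pN | exact: two].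
move=> N pN sp li; pose M := Defs.preim piA N.
have pM : is_prime M := preim_prime piA pN.
have MN r : M r <-> N (piA r) by [].
have k := kill _ _ MN pN.
have iN : is_ideal N by case: pN.
apply/(two_primes_over_nucleus MN iN); apply: two.
- have [Q1 [Q2 [pQ1 pQ2 n12 l1 l2]]] := split_unramified_two_primes su pN.
  apply: (two_primes_in_supp (Q1 := Defs.preim piB Q1) (Q2 := Defs.preim piB Q2)) => //.
  + exact: preim_prime.
  + exact: preim_prime.
  + by move=> H; apply: n12 => b; have [s <-] := surjB b; exact: H.
  + by move=> r; rewrite /Defs.preim -gE; exact: l1.
  + by move=> r; rewrite /Defs.preim -gE; exact: l2.
- exact/(loc_SPIR_surj surjA MN pM k).
- exact/(loc_infinite_surj surjA MN pM k).
Qed.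

End ConductorSquare.

Theorem theorem3p7 (R S : comNzRingType) (f : {rmorphism R -> S}) :
  injective f -> etale_ext f -> infra_integral_ext f -> Gilmer_ext f ->
  (FIP_ext f <->
     quotient_FMIR (conductor f) /\
     (forall M : R -> Prop, in_supp f M -> loc_SPIR M -> loc_infinite M ->
        two_primes_over f M)).
Proof.
move=> finj etf inff gilf.
have iC := conductor_ideal f.
(* When the conductor is the unit ideal the quotients are zero rings, outside [comNzRingType]. Then
   [f] is onto, the support is empty and both sides hold. *)
have [C1|C1] := pselect (conductor f 1).
  have fsurj := conductor1_surj C1.
  split=> _; last first.
    exists 1%N, (fun _ _ => True) => T [Tf _ _ _]; exists ord0 => s.
    by have [r <-] := fsurj s.
  split.
    exists 1%N, (fun _ _ => True) => I [iI CI]; exists ord0 => r.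
    by split=> // _; rewrite -[r]mulr1; apply: (idealMl _ iI); exact: CI.
  by move=> M sM; have := in_supp_conductor sM C1; case: sM => -[].
have nC1 : ~ push f (conductor f) 1.
  by move=> [c Cc]; rewrite -(rmorph1 f) => /finj c1; apply: C1; rewrite -c1.
have [A [piA [surjA kerA]]] := ideal_quotient iC C1.
have [B [piB [surjB kerB]]] := ideal_quotient (push_conductor_ideal f) nC1.
have [|g gE] := factor_rmorphism (pi := piA) (h := piB \o f) surjA.
  by move=> r /kerA Cr; apply/kerB; exists r.
exact: (FIP_nucleus finj etf inff gilf surjA kerA surjB kerB gE).
Qed.
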